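(* The morphism $\xi=\prod_i\xi_i:\tilde G\to(\mathbb{Z}/2\mathbb{Z})^{\alpha}$, the product over all $i$ such that $L_i$ is free of type $I^e_1$, is surjective; here $\alpha$ is the number of $i$ such that $L_i$ is free of type $I^e_1$.
   Context: Let $F$ be a finite unramified extension of $\mathbb{Q}_2$, $A$ its ring of integers and $\kappa=A/2A$. Let $L$ be a free $A$-module of rank $n$ with a quadratic form $q:L\to A$, $\langle x,y\rangle=\frac12(q(x+y)-q(x)-q(y))$, nondegenerate on $V=L\otimes_AF$, with $\langle L,L\rangle\subseteq A$. For a lattice $M\subset V$ put $M^{\perp}=\{x\in V:\langle x,M\rangle\subseteq A\}$. Jordan splitting: $L=\bigoplus_{i\ge0}L_i$ orthogonally, each $L_i$ zero or such that $2^{-i}\langle-,-\rangle$ on $L_i$ has Gram matrix over $A$ with unit determinant; $n_i=\mathrm{rank}\,L_i$. A nonzero $L_i$ is of type I if $2^{-i}q(L_i)$ contains a unit, type II otherwise; zero lattices are type II; $L_i=0$ for $i<0$. Type I with $n_i$ even is type $I^e$. $L_i$ is free if neither $L_{i-1}$ nor $L_{i+1}$ is of type I. For $i\ge0$: $A_i=\{x\in L:\langle x,L\rangle\subseteq 2^iA\}$, $b_i=2^{-i}\langle-,-\rangle\bmod2$ on $A_i/2A_i$; $X_i$ with $X_i/2A_i$ the radical of $b_i$; $B_i$ with $B_i/2A_i$ the kernel of $x\mapsto2^{-i}q(x)\bmod2$; $e\in A_i/X_i$ the unique vector with $b_i(v,e)^2=2^{-i}q(v)\bmod2$ for all $v$,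 $W_i$ the preimage of $\kappa e$; $Y_i$ with $Y_i/2A_i$ the radical of $b_i$ on $B_i/2A_i$; $Z_i$ with $Z_i/2A_i=\{x\in Y_i/2A_i:2^{-i-1}q(x)\equiv0\bmod2\}$; $\bar V_i=B_i/Z_i$. A free $L_i$ of type $I^e$ is of type $I^e_1$ if $\dim_\kappa\bar V_i$ is odd. For flat $R$, $M_R=M\otimes_AR$; $\underline M(R)$ is the set of $m\in\mathrm{End}_R(L_R)$ stabilizing $(A_i)_R,(B_i)_R,(W_i)_R,(X_i)_R,(Y_i)_R,(Z_i)_R$ for all $i$ with $m-1$ mapping $(A_i)_R\to(B_i)_R$, $(W_i)_R\to(X_i\cap Z_i)_R$, $((X_i\cap Z_i)^\perp)_R\to(W_i^\perp)_R$; it is represented by an affine space over $A$ with coordinate ring $A(\underline M)$; $\underline M^*=\mathrm{Spec}\,A(\underline M)_{\det}$; $\underline G\subset\underline M^*$ the stabilizer of $q$; $\tilde G=\underline G\otimes_A\kappa$. Definition of $\xi_i$ for $L_i$ free of type $I^e_1$: the linear form $2^{-i}\langle-,e\rangle\bmod 2$ on $A_i/X_i$ is fixed by $\underline G$. Choose any $A$-linear form $l$ on $A_i$ with $l\bmod 2=2^{-i}\langle -,e\rangle\bmod 2$ on $A_i/X_i$, and put $q'=l^2$. Then $\frac12(2^{-i}q+q')\bmod 2$ is a nonsingular quadratic form on the even-dimensional $\kappa$-space $A_i/X_i$, independent of $l$ and preserved by $\underline G$; this gives a morphism $\tilde G\to\mathrm{O}\big(A_i/X_i,\frac12(2^{-i}q+q')\big)$,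 and $\xi_i:\tilde G\to\mathbb{Z}/2\mathbb{Z}$ is its composition with the Dickson invariant. *)

(* Defs.v *)
From HB Require Import structures.
From mathcomp Require Import all_boot all_order all_algebra all_field.
From mathcomp Require Import boolp classical_sets.
Set Implicit Arguments.
Unset Strict Implicit.
Unset Printing Implicit Defensive.
Import GRing.Theory.
Local Open Scope classical_set_scope.
Local Open Scope ring_scope.

(* The ring Z_2 of 2-adic integers as the inverse limit of the Z/2^k, a class
   mod 2^k being represented by its least residue. *)

Record Z2 := MkZ2 {
  z2res :> nat -> nat;
  z2resP : forall k, (z2res k.+1 %% 2 ^ k)%N = z2res k }.

Lemma z2_eq (a b : Z2) : (forall k, a k = b k) -> a = b.
Proof.
case: a b => [a aP] [b bP] /= /funext eab; subst b.
by rewrite (Prop_irrelevance aP bP).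
Qed.

Lemma z2_mod (a : Z2) k : (a k %% 2 ^ k)%N = a k.
Proof. by rewrite -z2resP modn_mod. Qed.

Lemma z2_modS a k : ((a %% 2 ^ k.+1) %% 2 ^ k)%N = (a %% 2 ^ k)%N.
Proof. by rewrite modn_dvdm // expnS dvdn_mull. Qed.

Lemma z2_mod_le (a : Z2) k m : (k <= m)%N -> (a m %% 2 ^ k)%N = a k.
Proof.
move=> /subnK <-; elim: (m - k)%N => [|d IH]; first exact: z2_mod.
rewrite -IH addSn -(z2resP a (d + k)) modn_dvdm //.
by rewrite expnD dvdn_mull.
Qed.

Definition z2_of (f : nat -> nat)
    (fP : forall k, (f k.+1 = f k %[mod 2 ^ k])%N) : Z2.
Proof.
exists (fun k => (f k %% 2 ^ k)%N) => k; rewrite z2_modS; exact: fP.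
Defined.

Lemma z2_resE (a : Z2) k : (a k.+1 = a k %[mod 2 ^ k])%N.
Proof. by rewrite z2resP z2_mod. Qed.

Fact z2_constP c k : (c = c %[mod 2 ^ k])%N. Proof. by []. Qed.

Fact z2_addP (a b : Z2) k : (a k.+1 + b k.+1 = a k + b k %[mod 2 ^ k])%N.
Proof. by rewrite -modnDm !z2_resE modnDm. Qed.

Fact z2_mulP (a b : Z2) k : (a k.+1 * b k.+1 = a k * b k %[mod 2 ^ k])%N.
Proof. by rewrite -modnMm !z2_resE modnMm. Qed.

(* (2^k - 1) a = - a mod 2^k *)
Fact z2_oppP (a : Z2) k :
  ((2 ^ k.+1).-1 * a k.+1 = (2 ^ k).-1 * a k %[mod 2 ^ k])%N.
Proof.
rewrite -modnMm z2_resE modnMm; apply/eqP.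
have -> : (2 ^ k.+1).-1 = ((2 ^ k).-1 + 2 ^ k)%N.
  by rewrite expnS mul2n -addnn -subn1 -addnBAC ?subn1 // expn_gt0.
by rewrite mulnDl addnC [(2 ^ k * _)%N]mulnC modnMDl.
Qed.

Definition z2_zero := z2_of (z2_constP 0).
Definition z2_one := z2_of (z2_constP 1).
Definition z2_add a b := z2_of (z2_addP a b).
Definition z2_mul a b := z2_of (z2_mulP a b).
Definition z2_opp a := z2_of (z2_oppP a).

HB.instance Definition _ := gen_eqMixin Z2.
HB.instance Definition _ := gen_choiceMixin Z2.

Fact z2_addA : associative z2_add.
Proof. by move=> a b c; apply: z2_eq => k /=; rewrite modnDml modnDmr addnA. Qed.
Fact z2_addC : commutative z2_add.
Proof. by move=> a b; apply: z2_eq => k /=; rewrite addnC. Qed.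
Fact z2_add0 : left_id z2_zero z2_add.
Proof. by move=> a; apply: z2_eq => k /=; rewrite mod0n add0n z2_mod. Qed.
Fact z2_addN : left_inverse z2_zero z2_opp z2_add.
Proof.
move=> a; apply: z2_eq => k /=; rewrite modnDml mod0n -mulSnr prednK ?expn_gt0 //.
by rewrite modnMr.
Qed.
HB.instance Definition _ :=
  GRing.isZmodule.Build Z2 z2_addA z2_addC z2_add0 z2_addN.

Fact z2_mulA : associative z2_mul.
Proof. by move=> a b c; apply: z2_eq => k /=; rewrite modnMml modnMmr mulnA. Qed.
Fact z2_mulC : commutative z2_mul.
Proof. by move=> a b; apply: z2_eq => k /=; rewrite mulnC. Qed.
Fact z2_mul1 : left_id z2_one z2_mul.
Proof. by move=> a; apply: z2_eq => k /=; rewrite modnMml mul1n z2_mod. Qed.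
Fact z2_mulDl : left_distributive z2_mul z2_add.
Proof.
by move=> a b c; apply: z2_eq => k /=; rewrite modnMml modnDm mulnDl.
Qed.
Fact z2_one_neq0 : z2_one != 0 :> Z2.
Proof. by apply/eqP => /(congr1 (fun a : Z2 => a 1%N)). Qed.
HB.instance Definition _ := GRing.Zmodule_isComNzRing.Build Z2
  z2_mulA z2_mulC z2_mul1 z2_mulDl z2_one_neq0.

Definition z2_unit : {pred Z2} := [pred a | `[< exists b : Z2, b * a = 1 >]].
Definition z2_inv (a : Z2) : Z2 :=
  if pselect (exists b : Z2, b * a = 1) is left ab then projT1 (cid ab) else a.

Fact z2_mulV : {in z2_unit, left_inverse 1 z2_inv *%R}.
Proof.
move=> a /asboolP ab; rewrite /z2_inv; case: pselect => // ab'.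
by case: (cid ab').
Qed.
Fact z2_unitPl (a b : Z2) : b * a = 1 -> z2_unit a.
Proof. by move=> ab; apply/asboolP; exists b. Qed.
Fact z2_inv_out : {in [predC z2_unit], z2_inv =1 id}.
Proof.
move=> a; rewrite inE /= => /asboolP ab; rewrite /z2_inv.
by case: pselect.
Qed.
HB.instance Definition _ := GRing.ComNzRing_hasMulInverse.Build Z2
  z2_mulV z2_unitPl z2_inv_out.

Fact z2_integral : GRing.integral_domain_axiom Z2.
Proof.
move=> a b ab0; apply: contra_eqT ab0 => /norP[a0 b0].
have nz (c : Z2) : c != 0 -> exists k, c k != 0%N.
  move=> c0; apply: contrapT => /forallNP c0'; case/eqP: c0.
  by apply: z2_eq => k /=; rewrite mod0n; apply/eqP/negPn/negP/c0'.
have [k ak] := nz a a0; have [m bm] := nz b b0.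
apply/eqP => /(congr1 (fun c : Z2 => c (k + m)%N)) /= /eqP.
rewrite mod0n -/(dvdn _ _).
have nd (c : Z2) i j : c i != 0%N -> (i <= j)%N ->
    (0 < c j)%N /\ (logn 2 (c j) < i)%N.
  move=> ci ij; have cj : ~~ (2 ^ i %| c j)%N by rewrite /dvdn z2_mod_le.
  have c0 : (0 < c j)%N by rewrite lt0n; apply: contra cj => /eqP ->.
  by split=> //; rewrite ltnNge -pfactor_dvdn.
have [ap al] := nd a k (k + m)%N ak (leq_addr _ _).
have [bp bl] := nd b m (k + m)%N bm (leq_addl _ _).
rewrite pfactor_dvdn ?muln_gt0 ?ap ?bp // lognM // leqNgt.
by move=> /negP; apply; rewrite -addSn leq_add // ltnW.
Qed.
HB.instance Definition _ := GRing.ComUnitRing_isIntegral.Build Z2 z2_integral.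

Definition Q2 : fieldType := {fraction Z2}.

Section Integers.
Variable F : fieldExtType Q2.

Definition z2_in (a : Z2) : F := (tofrac a : Q2)%:A.

Fact z2_in_additive : zmod_morphism z2_in.
Proof. by move=> a b; rewrite /z2_in !raddfB /= scalerBl. Qed.
Fact z2_in_multiplicative : monoid_morphism z2_in.
Proof.
by split=> [|a b]; rewrite /z2_in ?rmorphM ?rmorph1 ?scale1r //= -scalerAl mul1r scalerA.
Qed.
HB.instance Definition _ := GRing.isZmodMorphism.Build Z2 F z2_in
  z2_in_additive.
HB.instance Definition _ :=
  GRing.isMonoidMorphism.Build Z2 F z2_in z2_in_multiplicative.

Definition integral_elt : {pred F} := [pred x | `[< integralOver z2_in x >]].

Fact integral_elt_subring : subring_closed integral_elt.
Proof.
split=> [|x y /asboolP xP /asboolP yP|x y /asboolP xP /asboolP yP];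
  apply/asboolP.
- exact: integral1.
- exact: integral_sub.
- exact: integral_mul.
Qed.
HB.instance Definition _ := GRing.isSubringClosed.Build F integral_elt
  integral_elt_subring.

(* the ring of integers: the integral closure of Z_2 in F *)
Record integers := MkInteger { integer_val :> F; _ : integer_val \in integral_elt }.
HB.instance Definition _ := [isSub for integer_val].
HB.instance Definition _ := [Choice of integers by <:].
HB.instance Definition _ := [SubChoice_isSubComNzRing of integers by <:].

Definition integers_in : {rmorphism integers -> F} := \val.

(* the ideal generated by 2 is the maximal ideal of the ring of integers *)
Definition unramified : Prop :=
  (~ exists y : integers, 2 * y = 1) /\
  forall x : integers,
    (exists y, x = 2 * y) \/ (exists y z, x * y = 1 + 2 * z).

End Integers.
Arguments integers_in F : clear implicits.

Section QuadraticForms.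
Variables (R : comNzRingType) (n : nat).

Definition polar (q : 'rV[R]_n -> R) (x y : 'rV[R]_n) : R :=
  q (x + y) - q x - q y.

Definition quadratic_form (q : 'rV[R]_n -> R) : Prop :=
  (forall a x, q (a *: x) = a ^+ 2 * q x) /\
  (forall a x y z, polar q (a *: x + y) z = a * polar q x z + polar q y z).

Definition preserves (q : 'rV[R]_n -> R) (m : 'M[R]_n) : Prop :=
  forall x, q (x *m m) = q x.

End QuadraticForms.

(* q_R : R^n -> R, for q : A^n -> A and an A-algebra f : A -> R *)
Definition qf_base (A R : comNzRingType) (f : A -> R) (n : nat)
    (q : 'rV[A]_n -> A) (x : 'rV[R]_n) : R :=
  \sum_(i < n) f (q (delta_mx 0 i)) * x 0 i ^+ 2
  + \sum_(i < n) \sum_(j < n | (i < j)%N)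
      f (polar q (delta_mx 0 i) (delta_mx 0 j)) * x 0 i * x 0 j.

(* Flatness of an A-algebra in its equational form: every linear relation with
   coefficients in A is a consequence of relations that hold in A. *)
Definition flat (A R : comNzRingType) (f : {rmorphism A -> R}) : Prop :=
  forall r (a : 'cV[A]_r) (x : 'rV[R]_r), x *m map_mx f a = 0 ->
    exists s (b : 'M[A]_(s, r)) (y : 'rV[R]_s),
      x = y *m map_mx f b /\ b *m a = 0.

(* The Dickson invariant of an element g of the orthogonal group of a
   nonsingular quadratic form on k^r, k a field of characteristic 2 and r even:
   rank (1 - g) mod 2. *)
Definition dickson (k : fieldType) (r : nat) (g : 'M[k]_r) : 'Z_2 :=
  (\rank (g - 1%:M))%:R.

(* L = A^n inside V = F^n; End(L_R) is 'M[R]_n acting on row vectors on the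
   right. All lattices are subsets of V. *)
Section Lattices.
Variables (F : fieldType) (A : comNzRingType) (iota : {rmorphism A -> F}).
Variables (n : nat) (q : 'rV[A]_n -> A).
Local Notation V := 'rV[F]_n.

Definition pA (i : nat) : set F := [set x | exists a : A, x = 2 ^+ i * iota a].

Definition is_unit (a : A) : Prop := exists b, a * b = 1.

Definition latL : set V := [set x | exists y : 'rV[A]_n, x = map_mx iota y].

Definition gram : 'M[F]_n :=
  \matrix_(i, j) (iota (polar q (delta_mx 0 i) (delta_mx 0 j)) / 2).

(* the F-bilinear extension of <x, y> = (q (x + y) - q x - q y) / 2 to V *)
Definition bil (x y : V) : F := (x *m gram *m y^T) 0 0.

Definition qV (x : V) : F := bil x x.

Definition bil_integral : Prop :=
  forall x y, latL x -> latL y -> pA 0 (bil x y).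

Definition bil_nondegenerate : Prop :=
  forall x, (forall y, bil x y = 0) -> x = 0.

Definition lat_dual (N : set V) : set V :=
  [set x | forall y, N y -> pA 0 (bil x y)].

Definition latA i : set V :=
  [set x | latL x /\ forall y, latL y -> pA i (bil x y)].

Definition latX i : set V :=
  [set x | latA i x /\ forall y, latA i y -> pA i.+1 (bil x y)].

Definition latB i : set V := [set x | latA i x /\ pA i.+1 (qV x)].

(* e : V represents the vector e of A_i / X_i *)
Definition is_e i (e : V) : Prop :=
  latA i e /\
  forall v, latA i v -> pA 1 ((bil v e / 2 ^+ i) ^+ 2 - qV v / 2 ^+ i).

Definition latW i : set V :=
  [set x | latA i x /\ exists e a, is_e i e /\ latX i (x - iota a *: e)].

Definition latY i : set V :=
  [set x | latB i x /\ forall y, latB i y -> pA i.+1 (bil x y)].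

Definition latZ i : set V := [set x | latY i x /\ pA i.+2 (qV x)].

(* The rows of a represent a kappa-basis of N / N', for 2 N <= N' <= N <= L. *)
Definition quot_basis (N N' : set V) r (a : 'M[A]_(r, n)) : Prop :=
  [/\ forall s, N (map_mx iota (row s a)),
      forall x, N x -> exists c : 'rV[A]_r, N' (x - map_mx iota (c *m a)) &
      forall c : 'rV[A]_r, N' (map_mx iota (c *m a)) ->
        forall s, exists b, c 0 s = 2 * b].

Definition quot_dim (N N' : set V) (r : nat) : Prop :=
  exists a : 'M[A]_(r, n), quot_basis N N' a.

Record jordan_splitting (J : nat -> set V) (rk : nat -> nat) : Prop := {
  jordan_basis : forall i, exists b : 'M[A]_(rk i, n),
    [/\ J i = [set x | exists c : 'rV[A]_(rk i), x = map_mx iota (c *m b)],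
        forall c : 'rV[A]_(rk i), c *m b = 0 -> c = 0 &
        exists U : 'M[A]_(rk i), is_unit (\det U) /\
          forall s t, bil (map_mx iota (row s b)) (map_mx iota (row t b)) / 2 ^+ i
                      = iota (U s t)];
  jordan_orthogonal : forall i j x y, i <> j -> J i x -> J j y -> bil x y = 0;
  jordan_sum : forall x, latL x -> exists N (c : nat -> V),
    (forall i, J i (c i)) /\ x = \sum_(i < N) c i;
  jordan_direct : forall N (c : nat -> V), (forall i, J i (c i)) ->
    \sum_(i < N) c i = 0 -> forall i, (i < N)%N -> c i = 0 }.

Definition type_I (J : nat -> set V) i : Prop :=
  exists x a, [/\ J i x, is_unit a & qV x / 2 ^+ i = iota a].

Definition free_at (J : nat -> set V) i : Prop :=
  forall j, j.+1 = i \/ j = i.+1 -> ~ type_I J j.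

Definition free_type_Ie1 (J : nat -> set V) (rk : nat -> nat) i : Prop :=
  [/\ free_at J i, type_I J i, ~~ odd (rk i) &
      exists r, quot_dim (latB i) (latZ i) r /\ odd r].

Section BaseChange.
Variables (R : comNzRingType) (f : {rmorphism A -> R}).

(* N_R, for N <= L and R flat, as a submodule of L_R = R^n *)
Definition lat_base (N : set V) : set 'rV[R]_n :=
  [set x | exists t (c : 'rV[R]_t) (y : 'M[A]_(t, n)),
    (forall u, N (map_mx iota (row u y))) /\ x = c *m map_mx f y].

Definition lat_scale s (N : set V) : set V :=
  [set x | exists y, N y /\ x = 2 ^+ s *: y].

(* m maps N_R to N'_R. Lattices not contained in L are first multiplied by a
   power of 2, which is injective on V tensor R as R is flat. *)
Definition lat_maps (m : 'M[R]_n) (N N' : set V) : Prop :=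
  forall s, lat_scale s N `<=` latL -> lat_scale s N' `<=` latL ->
    forall x, lat_base (lat_scale s N) x -> lat_base (lat_scale s N') (x *m m).

Definition in_M (m : 'M[R]_n) : Prop :=
  forall i,
    [/\ lat_maps m (latA i) (latA i), lat_maps m (latB i) (latB i),
        lat_maps m (latW i) (latW i), lat_maps m (latX i) (latX i) &
        lat_maps m (latY i) (latY i) /\ lat_maps m (latZ i) (latZ i)] /\
    [/\ lat_maps (m - 1%:M) (latA i) (latB i),
        lat_maps (m - 1%:M) (latW i) (latX i `&` latZ i) &
        lat_maps (m - 1%:M) (lat_dual (latX i `&` latZ i)) (lat_dual (latW i))].

Definition in_Mstar (m : 'M[R]_n) : Prop :=
  in_M m /\ exists u, \det m * u = 1.

Definition in_G (m : 'M[R]_n) : Prop :=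
  in_Mstar m /\ preserves (qf_base f q) m.

End BaseChange.

(* B is the coordinate ring of the flat group scheme G and g : G(B) its
   universal point: B is flat and Hom_A(B, R) = G(R) for all flat R. *)
Definition represents_G (B : comNzRingType) (f : {rmorphism A -> B})
    (g : 'M[B]_n) : Prop :=
  [/\ flat f, in_G f g &
      forall (R : comNzRingType) (h : {rmorphism A -> R}) (m : 'M[R]_n),
        flat h -> in_G h m ->
        let classifies (psi : {rmorphism B -> R}) :=
          (forall a, psi (f a) = h a) /\ map_mx psi g = m in
        (exists psi, classifies psi) /\
        (forall psi psi', classifies psi -> classifies psi' -> psi =1 psi')].

Definition linear_form_lift i (e : V) (l : V -> F) : Prop :=
  [/\ forall x, latA i x -> pA 0 (l x),
      forall a x y, latA i x -> latA i y ->
        l (iota a *: x + y) = iota a * l x + l y &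
      forall x, latA i x -> pA 1 (l x - bil x e / 2 ^+ i)].

(* (2^-i q + q') / 2 with q' = l^2 *)
Definition q_half i (l : V -> F) (x : V) : F := (qV x / 2 ^+ i + l x ^+ 2) / 2.

(* d is the value of xi_i at the point phi : B -> k of the special fibre: a is
   a basis of A_i / X_i, T the matrix of g on it modulo (X_i)_B, and Q the form
   (2^-i q + q') / 2 in this basis. *)
Definition xi_value (B : comNzRingType) (f : {rmorphism A -> B}) (g : 'M[B]_n)
    i (k : fieldType) (phi : {rmorphism B -> k}) (d : 'Z_2) : Prop :=
  exists e l r (a : 'M[A]_(r, n)) (Q : 'rV[A]_r -> A) (T : 'M[B]_r),
  [/\ is_e i e /\ linear_form_lift i e l,
      quot_basis (latA i) (latX i) a,
      forall c, iota (Q c) = q_half i l (map_mx iota (c *m a)),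
      forall s, lat_base f (latX i)
        (row s (map_mx f a *m g - T *m map_mx f a)) &
      preserves (qf_base (phi \o f) Q) (map_mx phi T) /\
      d = dickson (map_mx phi T)].

End Lattices.

(* Main.v *)
(* The special fibre of G has enough points coming from G(A), composed with
   A -> A/2A.  If L_i is free of type I^e_1, then 2^(-i-1) q takes a unit value
   on Y_i (otherwise B_i/Z_i would carry a nonsingular alternating form,
   contradicting its odd dimension), and the L_i-component of such a vector is
   a multiple of a representative e_i in L_i of e with q(e_i) = 2^(i+1) u, u a
   unit.  The orthogonal reflection in e_i is therefore integral; it lies in
   G(A), acts on A_i/X_i = L_i/2L_i as a transvection, hence with Dickson
   invariant 1, and is trivial on every other L_j.  Products of such reflections
   realise all values of xi. *)
Require Import Defs.
From HB Require Import structures.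
From mathcomp Require Import all_boot all_order all_algebra all_field.
From mathcomp Require Import ring_quotient.
From mathcomp Require Import boolp classical_sets.
From mathcomp Require Import ring zify.
Set Implicit Arguments.
Unset Strict Implicit.
Unset Printing Implicit Defensive.
Import GRing.Theory.
Local Open Scope classical_set_scope.
Local Open Scope ring_scope.

(** * 2-adic integers and rings of integers *)

(** [represents_G] describes B only through its points in flat A-algebras, and A/2A is not flat;
    hence the lift to G(A) before reducing. The reflection x - (2<x,e>/q(e)) e is integral only if
    q(e) has valuation no larger than i+1, because <x,e> is merely known to lie in 2^i A; an
    arbitrary representative of the class e may have a larger valuation, and the odd dimension of
    B_i/Z_i is what excludes this for a suitable one. The condition on e involves squares, so
    proportionality to e is obtained by taking square roots modulo 2; this uses that A/2A is
    perfect, which is derived from integrality over Z_2 by a pigeonhole argument on powers.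
    Reflections at different indices have orthogonal axes, so any product of them is a single
    self-adjoint involution. For such an involution all conditions defining G(A) reduce to one: s -
    1 maps W_i into X_i ∩ Z_i, for every i and not only for the indices of the chosen L_i. *)

Lemma z2_natE (m k : nat) : (m%:R : Z2) k = (m %% 2 ^ k)%N.
Proof.
elim: m => [|m IH]; first by rewrite mulr0n /= !mod0n.
by rewrite -natr1 /= IH modnDm addn1.
Qed.

Lemma z2_two_neq0 : 2 != 0 :> Z2.
Proof. by apply/eqP => /(congr1 (fun a : Z2 => a 2%N)); rewrite z2_natE. Qed.

Lemma z2_res_expM2 (x : Z2) k : (2 ^+ k * x) k = 0%N.
Proof. by rewrite -natrX /= z2_natE modnn mul0n mod0n. Qed.

(** The inverse is the geometric series in 2x: k terms suffice for the residue at level k, since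
    (2x)^k vanishes modulo 2^k. *)
Lemma z2_geom_unit (x : Z2) : exists y : Z2, (1 - 2 * x) * y = 1.
Proof.
pose s k : Z2 := \sum_(j < k) (2 * x) ^+ j.
have sP k : (s k.+1 k.+1 = s k k %[mod 2 ^ k])%N.
  rewrite z2resP /s big_ord_recr /= exprMn z2_res_expM2 addn0.
  by rewrite !z2_mod.
exists (z2_of sP); apply: z2_eq => k.
transitivity (((1 - 2 * x) * s k) k); first by rewrite /= modnMmr.
have -> : (1 - 2 * x) * s k = 1 + 2 ^+ k * - x ^+ k.
  by rewrite -[1 - 2 * x]opprB mulNr -subrX1 exprMn opprB mulrN.
transitivity (((1%R : Z2) k + (2 ^+ k * - x ^+ k)%R k) %% 2 ^ k)%N => //.
by rewrite z2_res_expM2 addn0 z2_mod.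
Qed.

Lemma z2_mod2 (x : Z2) : exists (c : bool) y, x = c%:R + 2 * y.
Proof.
(* Halving loses one binary digit, so level k of the quotient is read off level k+1 of x. *)
have hP k : (x k.+2 %/ 2 = x k.+1 %/ 2 %[mod 2 ^ k])%N.
  rewrite {1}(divn_eq (x k.+2) (2 ^ k.+1)) z2resP.
  by rewrite expnSr mulnA divnMDl // modnMDl.
exists (odd (x 1)), (z2_of hP); apply: z2_eq => k.
have -> : (odd (x 1)) = odd (x k.+1) :> bool.
  have /(congr1 odd) <- : (x k.+1 %% 2 ^ 1)%N = x 1 by apply: z2_mod_le.
  by rewrite expn1 modn2 oddb.
transitivity ((odd (x k.+1) + 2 * (x k.+1 %/ 2)) %% 2 ^ k)%N.
  by rewrite mulnC addnC -modn2 -divn_eq z2resP.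
pose b : Z2 := (odd (x k.+1))%:R.
transitivity ((b k + (2%R : Z2) k * (x k.+1 %/ 2 %% 2 ^ k) %% 2 ^ k) %% 2 ^ k)%N => //.
by rewrite !z2_natE modnMm modnDm.
Qed.

Section Integers.
Variable F : fieldExtType Q2.
Local Notation A := (integers F).

Lemma fieldext_two_neq0 : 2 != 0 :> F.
Proof.
have -> : 2 = z2_in F 2 :> F by rewrite rmorph_nat.
rewrite /z2_in scaler_eq0 oner_eq0 orbF.
by rewrite tofrac_eq0 z2_two_neq0.
Qed.

Lemma integers_in_inj : injective (integers_in F).
Proof. exact: val_inj. Qed.

Lemma z2_in_integral (a : Z2) : z2_in F a \in @integral_elt F.
Proof. by apply/asboolP/integral_id. Qed.

(* Substituting z = (w - 1) / 2 in a monic equation of z and clearing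
   denominators shows that w divides an element of 1 + 2 Z_2. *)
Lemma integers_unit_1D2 (z : A) : exists v, (1 + 2 * z) * v = 1.
Proof.
have zI := valP z; have /asboolP[p pm] := zI.
set x : F := val z => /rootP rp.
pose w := 1 + 2 * x; pose d := (size p).-1.
have pd : p`_d = 1 by apply/eqP; rewrite -/(lead_coef p) -monicE.
have sp : size p = d.+1.
  by rewrite /d prednK // lt0n size_poly_eq0 monic_neq0.
pose c := \sum_(j < size p) p`_j * (-2) ^+ (d - j).
pose h := \sum_(j < size p) z2_in F (p`_j * (-2) ^+ (d - j))
           * \sum_(i < j) (1 - w) ^+ i.
have cwh : z2_in F c = w * h.
  apply/eqP; rewrite -subr_eq0; apply/eqP.
  transitivity ((-2) ^+ d * (map_poly (z2_in F) p).[x]); last by rewrite rp mulr0.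
  rewrite horner_coef size_map_poly_id0; last first.
    by rewrite (monicP pm) rmorph1 oner_eq0.
  rewrite raddf_sum mulr_sumr -sumrB mulr_sumr; apply: eq_bigr => j _.
  rewrite coef_map /=.
  have jd : (j <= d)%N by rewrite -ltnS -sp ltn_ord.
  have -> : (-2) ^+ d = (-2) ^+ (d - j) * (-2) ^+ j :> F by rewrite -exprD subnK.
  have E : (-2) ^+ j * x ^+ j = 1 - w * \sum_(i < j) (1 - w) ^+ i.
    have := subrX1 (1 - w) j; rewrite addrAC subrr add0r mulNr => <-.
    by rewrite addrC subrK -exprMn; congr (_ ^+ _); rewrite /w; ring.
  rewrite !rmorphM rmorphXn rmorphN rmorph_nat.
  rewrite [X in _ = X](_ : _ = z2_in F p`_j * (-2) ^+ (d - j) * ((-2) ^+ j * x ^+ j)); last by ring.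
  by rewrite E; ring.
have [b cb] : exists b, c = 1 - 2 * b.
  rewrite /c sp big_ord_recr /= subnn mulr1 pd.
  exists (\sum_(i < d) p`_i * (-2) ^+ (d - i.+1)).
  rewrite addrC mulr_sumr -sumrN; congr (_ + _); apply: eq_bigr => i _.
  by rewrite -{1}(subnSK (ltn_ord i)) exprS; ring.
have [y cy] := z2_geom_unit b.
have wI : w \in @integral_elt F by rewrite rpredD ?rpred1 // rpredM // rpred_nat.
have hI : h * z2_in F y \in @integral_elt F.
  rewrite rpredM ?z2_in_integral // rpred_sum // => j _.
  rewrite rpredM ?z2_in_integral // rpred_sum // => k _.
  by rewrite rpredX // rpredB // rpred1.
exists (MkInteger hI); apply: val_inj.
by rewrite rmorphM rmorphD rmorphM rmorph_nat rmorph1 /= mulrA -cwh -rmorphM cb cy rmorph1.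
Qed.

Hypothesis unr : unramified F.

(** [unramified] only provides inverses modulo 2; they lift because 1 + 2A consists of units. *)
Lemma unramified_unit (x : A) : (exists y, x = 2 * y) \/ (exists y, x * y = 1).
Proof.
have [xe|[y [z xy]]] := unr.2 x; first by left.
have [v zv] := integers_unit_1D2 z.
by right; exists (y * v); rewrite mulrA xy.
Qed.

Lemma unramified_radical (x y : A) : x ^+ 2 = 2 * y -> exists z, x = 2 * z.
Proof.
move=> xy; have [//|[z xz]] := unramified_unit x; case: unr.1.
by exists (y * z ^+ 2); rewrite mulrA -xy -exprMn xz expr1n.
Qed.

(** A/2A is reduced, so its Frobenius is injective: (u - v)^2 differs from u^2 - v^2 by the even
    element 2v(u - v). *)
Lemma unramified_frobenius_inj k (x y z : A) :
  x ^+ (2 ^ k) - y ^+ (2 ^ k) = 2 * z -> exists t, x - y = 2 * t.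
Proof.
elim: k z => [|k IH] z; first by rewrite expn0 !expr1; exists z.
rewrite expnSr !exprM.
set u := x ^+ _; set v := y ^+ _ => E.
have /unramified_radical[t] : (u - v) ^+ 2 = 2 * (z - v * (u - v)).
  by rewrite mulrBr -E; ring.
exact: IH.
Qed.

(* Modulo 2 the powers of x are combinations of 1, .., x^(d-1) with
   coefficients 0 or 1, hence finite in number. *)
Lemma integers_powers_mod2 (x : A) : exists d, forall N,
  exists (c : {ffun 'I_d -> bool}) z, x ^+ N = \sum_j (c j)%:R * x ^+ j + 2 * z.
Proof.
have xI := valP x; have /asboolP[p pm /rootP rp] := xI.
exists (size p) => N.
have /(congr1 (fun r => (map_poly (z2_in F) r).[val x])) :=
  Pdiv.RingMonic.rdivp_eq pm 'X^N.
set r := Pdiv.CommonRing.rmodp _ _.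
have sr : (size r <= size p)%N.
  by rewrite ltnW // Pdiv.CommonRing.ltn_rmodpN0 // monic_neq0.
rewrite rmorphD rmorphM !hornerE rp mulr0 add0r map_polyXn hornerXn.
have -> : (map_poly (z2_in F) r).[val x] = \sum_(j < size p) z2_in F r`_j * val x ^+ j.
  rewrite (@horner_coef_wide _ (size p)) ?(leq_trans (size_poly _ _)) //.
  by apply: eq_bigr => j _; rewrite coef_map.
have /choice[c cP] : forall j : 'I_(size p), exists cy : bool * Z2, r`_j = cy.1%:R + 2 * cy.2.
  by move=> j; have [c [y ->]] := z2_mod2 r`_j; exists (c, y).
move=> xN; exists [ffun j => (c j).1].
have zI : \sum_(j < size p) z2_in F (c j).2 * val x ^+ j \in @integral_elt F.
  by rewrite rpred_sum // => j _; rewrite rpredM ?z2_in_integral // rpredX.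
exists (MkInteger zI); apply: val_inj.
rewrite rmorphXn xN rmorphD rmorphM rmorph_nat raddf_sum [X in _ = _ + 2 * X]/= mulr_sumr -big_split.
apply: eq_bigr => j _.
rewrite cP rmorphD rmorphM !rmorph_nat ffunE.
rewrite mulrDl -mulrA; congr (_ + _).
transitivity (integers_in F ((c j).1%:R * x ^+ j)) => //.
by rewrite rmorphM rmorph_nat rmorphXn.
Qed.

(** The iterated squares of x take finitely many values modulo 2, so two of them agree; cancelling
    the smaller power of Frobenius by injectivity shows x congruent to x^(2^m) with m > 0, a
    square. *)
Lemma integers_perfect (x : A) : exists y z, x = y ^+ 2 + 2 * z.
Proof.
have [d /choice[c cP]] := integers_powers_mod2 x.
pose T := {ffun 'I_d -> bool}.
have [i [j [ij cij]]] : exists i j, (i < j)%N /\ c (2 ^ i)%N = c (2 ^ j)%N.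
  pose h (i : 'I_(#|T|.+1)) : T := c (2 ^ i)%N.
  have : ~~ injectiveb h.
    by apply/injectiveP => /leq_card; rewrite card_ord ltnn.
  case/injectivePn => i [j ij hij].
  have [lij|lji|/val_inj eij] := ltngtP i j; first by exists i, j.
    by exists j, i.
  by rewrite eij eqxx in ij.
have [z1 E1] := cP (2 ^ i)%N; have [z2 E2] := cP (2 ^ j)%N.
have [t] : exists t, x - x ^+ (2 ^ (j - i)) = 2 * t.
  apply: (@unramified_frobenius_inj i _ _ (z1 - z2)).
  by rewrite -exprM -expnD subnK ?(ltnW ij) // E1 E2 cij; ring.
have -> : (2 ^ (j - i) = 2 ^ (j - i).-1 * 2)%N by rewrite -expnSr prednK // subn_gt0.
rewrite exprM => E; exists (x ^+ (2 ^ (j - i).-1)), t.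
by rewrite -E; ring.
Qed.

End Integers.

(** * The residue field A/2A *)

Section ResidueField.
Variable A : comNzRingType.
Hypothesis two_nunit : ~ exists y : A, 2 * y = 1.
Hypothesis two_max :
  forall x : A, (exists y, x = 2 * y) \/ (exists y z, x * y = 1 + 2 * z).

Definition even_elt : {pred A} := [pred x | `[< exists y, x = 2 * y >]].

Fact even_elt_ideal : idealr_closed even_elt.
Proof.
split; first by apply/asboolP; exists 0; rewrite mulr0.
  by apply/asboolP => -[y y1]; apply: two_nunit; exists y.
move=> a u v /asboolP[u' ->] /asboolP[v' ->]; apply/asboolP.
by exists (a * u' + v'); ring.
Qed.

HB.instance Definition _ := isIdealr.Build A even_elt even_elt_ideal.

Local Notation pi := (\pi_({ideal_quot even_elt})%qT).

Lemma even_quotP (x : A) : pi x = 0 <-> exists y, x = 2 * y.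
Proof.
have -> : 0 = pi 0 by rewrite rmorph0.
split=> [/eqP|xe].
  by rewrite -Quotient.idealrBE subr0 => /asboolP.
by apply/eqP; rewrite -Quotient.idealrBE subr0; apply/asboolP.
Qed.

(** The second clause fixes the inverse of 0 to be 0, as the field structure demands. *)
Fact even_quot_invP (x : {ideal_quot even_elt}) :
  exists y, (x != 0 -> y * x = 1) /\ (x = 0 -> y = 0).
Proof.
have [->|x0] := eqVneq x 0; first by exists 0.
move: x0; rewrite -[x]reprK; set a := repr x => x0.
have [/even_quotP a0|[y [z ayz]]] := two_max a; first by rewrite a0 eqxx in x0.
exists (pi y); split=> [_|a0]; last by rewrite a0 eqxx in x0.
rewrite -rmorphM mulrC ayz rmorphD rmorph1.
by rewrite [X in 1 + X](_ : _ = 0) ?addr0 //; apply/even_quotP; exists z.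
Qed.

Definition even_quot_inv x := projT1 (cid (even_quot_invP x)).

Fact even_quot_mulVf x : x != 0 -> even_quot_inv x * x = 1.
Proof. by rewrite /even_quot_inv; case: (cid _) => y []. Qed.

Fact even_quot_inv0 : even_quot_inv 0 = 0.
Proof. by rewrite /even_quot_inv; case: (cid _) => y h; apply: h.2. Qed.

HB.instance Definition _ := GRing.ComNzRing_isField.Build
  {ideal_quot even_elt} even_quot_mulVf even_quot_inv0.

Lemma residue_field_exists : exists (k : fieldType) (p : {rmorphism A -> k}),
  (forall y, exists x, p x = y) /\ (forall x, p x = 0 <-> exists y, x = 2 * y).
Proof.
exists {ideal_quot even_elt}, pi; split=> [y|]; last exact: even_quotP.
by exists (repr y); apply: reprK.
Qed.

End ResidueField.

(** * Quadratic forms and their base change *)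

Lemma quadratic_form_polarxx (R : comNzRingType) n (q : 'rV[R]_n -> R) x :
  quadratic_form q -> polar q x x = 2 * q x.
Proof.
case=> qZ _; have := qZ 2 x; rewrite /polar scaler_nat mulr2n => ->; ring.
Qed.

Lemma polarC (R : comNzRingType) n (q : 'rV[R]_n -> R) x y :
  polar q x y = polar q y x.
Proof. by rewrite /polar [x + y]addrC; ring. Qed.

Section PolarExpansion.
Variables (R : comNzRingType) (n : nat) (q : 'rV[R]_n -> R).
Hypothesis qf : quadratic_form q.

Lemma polarD x y z : polar q (x + y) z = polar q x z + polar q y z.
Proof. by have := qf.2 1 x y z; rewrite scale1r mul1r. Qed.

Lemma polar0 z : polar q 0 z = 0.
Proof. by have := polarD 0 0 z; rewrite addr0 => /eqP; rewrite eq_sym addrC -subr_eq0 addrK => /eqP. Qed.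

Lemma polarZ a x z : polar q (a *: x) z = a * polar q x z.
Proof. by have := qf.2 a x 0 z; rewrite !addr0 polar0 addr0. Qed.

Lemma polar_sum (I : finType) (v : I -> 'rV[R]_n) z :
  polar q (\sum_i v i) z = \sum_i polar q (v i) z.
Proof.
by apply: (big_morph (fun x => polar q x z)); [move=> *; apply: polarD | apply: polar0].
Qed.

Lemma polar_expand x y : polar q x y =
  \sum_i \sum_j x 0 i * y 0 j * polar q (delta_mx 0 i) (delta_mx 0 j).
Proof.
rewrite {1}(row_sum_delta x) polar_sum; apply: eq_bigr => i _.
rewrite polarZ polarC {1}(row_sum_delta y) polar_sum mulr_sumr.
by apply: eq_bigr => j _; rewrite polarZ polarC mulrA.
Qed.

Hypothesis reg2 : forall x y : R, 2 * x = 2 * y -> x = y.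

(** The upper triangular expansion of q is verified after doubling: 2q(x) = [polar q x x] expands
    bilinearly over all pairs, the two triangles coincide by symmetry, and [reg2] cancels the 2. *)
Lemma qf_base_map (S : comNzRingType) (h : {rmorphism R -> S}) x :
  qf_base h q (map_mx h x) = h (q x).
Proof.
have -> : q x = qf_base idfun q x.
  apply: reg2; rewrite -quadratic_form_polarxx // polar_expand.
  pose G i j := x 0 i * x 0 j * polar q (delta_mx 0 i) (delta_mx 0 j).
  have GC i j : G i j = G j i by rewrite /G polarC; ring.
  transitivity (\sum_i (G i i + \sum_(j < n | (i < j)%N) G i j + \sum_(j < n | (j < i)%N) G i j)).
    apply: eq_bigr => i _; rewrite (bigD1 i) //= -addrA; congr (_ + _).
    rewrite (bigID (fun j : 'I_n => (i < j)%N)) /=; congr (_ + _).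
      by apply: eq_bigl => j; rewrite -val_eqE /=; case: ltngtP.
    by apply: eq_bigl => j; rewrite -val_eqE /=; case: ltngtP.
  have Es : \sum_(i < n) \sum_(j < n | (j < i)%N) G i j =
            \sum_(i < n) \sum_(j < n | (i < j)%N) G i j.
    rewrite (exchange_big_dep xpredT) //=.
    by apply: eq_bigr => i _; apply: eq_bigr => j _; rewrite GC.
  rewrite !big_split /= Es.
  rewrite /qf_base [RHS]mulrDr -addrA; congr (_ + _).
    rewrite mulr_sumr; apply: eq_bigr => i _.
    by rewrite /G quadratic_form_polarxx //=; ring.
  rewrite -[X in X + _ = _]mul1r -[X in _ + X = _]mul1r.
  rewrite -mulrDl; congr (_ * _); apply: eq_bigr => i _; apply: eq_bigr => j _.
  by rewrite /G /=; ring.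
rewrite /qf_base rmorphD !rmorph_sum; congr (_ + _); apply: eq_bigr => i _.
  by rewrite rmorphM rmorphXn mxE.
rewrite rmorph_sum; apply: eq_bigr => j _.
by rewrite !rmorphM !mxE.
Qed.

End PolarExpansion.

Lemma eq_qf_base (R S : comNzRingType) n (h h' : R -> S) (q : 'rV[R]_n -> R) x :
  h =1 h' -> qf_base h q x = qf_base h' q x.
Proof. by move=> /funext ->. Qed.

(** * Divisibility by powers of 2 inside F *)

Section TwoAdic.
Variables (F : fieldType) (A : comNzRingType) (iota : {rmorphism A -> F}).
Hypothesis iota_inj : injective iota.
Hypothesis two_neq0 : 2 != 0 :> F.
Local Notation pA := (pA iota).

Lemma pow2_neq0 i : 2 ^+ i != 0 :> F. Proof. by rewrite expf_neq0. Qed.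

Lemma integers_reg2 (x y : A) : 2 * x = 2 * y -> x = y.
Proof.
move=> /(congr1 iota); rewrite !rmorphM rmorph_nat => /(mulfI two_neq0).
exact: iota_inj.
Qed.

Lemma map_iota_inj m k : injective (fun X : 'M[A]_(m, k) => map_mx iota X).
Proof.
move=> X Y /matrixP E; apply/matrixP => i j.
by have := E i j; rewrite !mxE => /iota_inj.
Qed.

Lemma pA_iota a : pA 0 (iota a). Proof. by exists a; rewrite mul1r. Qed.

Lemma pA0 i : pA i 0. Proof. by exists 0; rewrite rmorph0 mulr0. Qed.

Lemma pAD i x y : pA i x -> pA i y -> pA i (x + y).
Proof. by move=> [a ->] [b ->]; exists (a + b); rewrite rmorphD mulrDr. Qed.

Lemma pAN i x : pA i x -> pA i (- x).
Proof. by move=> [a ->]; exists (- a); rewrite rmorphN mulrN. Qed.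

Lemma pAB i x y : pA i x -> pA i y -> pA i (x - y).
Proof. by move=> ? ?; apply: pAD => //; apply: pAN. Qed.

Lemma pA_sum (I : Type) (r : seq I) (P : pred I) i (v : I -> F) :
  (forall k, P k -> pA i (v k)) -> pA i (\sum_(k <- r | P k) v k).
Proof. by move=> H; apply: big_ind => //; [apply: pA0 | apply: pAD]. Qed.

Lemma pAM i j x y : pA i x -> pA j y -> pA (i + j) (x * y).
Proof.
by move=> [a ->] [b ->]; exists (a * b); rewrite exprD rmorphM; ring.
Qed.

Lemma pA_scale i a x : pA i x -> pA i (iota a * x).
Proof. exact: (pAM (pA_iota a)). Qed.

Lemma pA_le i j x : (i <= j)%N -> pA j x -> pA i x.
Proof.
move=> ij [a ->]; exists (2 ^+ (j - i) * a).
by rewrite rmorphM rmorphXn rmorph_nat mulrA -exprD subnKC.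
Qed.

Lemma pA_pow2 i : pA i (2 ^+ i).
Proof. by exists 1; rewrite rmorph1 mulr1. Qed.

Lemma pA_pow2M i j x : pA (i + j) (2 ^+ i * x) <-> pA j x.
Proof.
split=> [[a]|]; last by apply: pAM (pA_pow2 i).
by rewrite exprD -mulrA => /(mulfI (pow2_neq0 _)) ->; exists a.
Qed.

Lemma pA_2M j x : pA j.+1 (2 * x) <-> pA j x.
Proof. by rewrite -{1}[2]expr1 -add1n pA_pow2M. Qed.

Lemma pA_div i j x : pA (i + j) x <-> pA j (x / 2 ^+ i).
Proof.
by have := pA_pow2M i j (x / 2 ^+ i); rewrite [2 ^+ i * _]mulrC divfK // pow2_neq0.
Qed.

Lemma pA_div0 i x : pA i x <-> pA 0 (x / 2 ^+ i).
Proof. by rewrite -[i in pA i _]addn0; apply: pA_div. Qed.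

Lemma pA_div1 i x : pA i.+1 x <-> pA 1 (x / 2 ^+ i).
Proof. by rewrite -addn1; apply: pA_div. Qed.

Lemma pA1P a : pA 1 (iota a) <-> exists b, a = 2 * b.
Proof.
split=> [[b]|[b ->]]; last by exists b; rewrite rmorphM rmorph_nat.
by rewrite expr1 -(rmorph_nat iota) -rmorphM => /iota_inj ->; exists b.
Qed.

End TwoAdic.

(** * Lattices in a quadratic space *)

Section Lattices.
Variables (F : fieldType) (A : comNzRingType) (iota : {rmorphism A -> F}).
Hypothesis iota_inj : injective iota.
Hypothesis two_neq0 : 2 != 0 :> F.
Variables (n : nat) (q : 'rV[A]_n -> A).
Hypothesis qf : quadratic_form q.
Local Notation V := 'rV[F]_n.
Local Notation pA := (pA iota).
Local Notation bil := (bil iota q).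
Local Notation qV := (qV iota q).
Local Notation latL := (@latL F A iota n).
Local Notation latA := (latA iota q).
Local Notation latX := (latX iota q).
Local Notation latB := (latB iota q).
Local Notation latW := (latW iota q).
Local Notation latY := (latY iota q).
Local Notation latZ := (latZ iota q).
Implicit Types x y z : V.

Lemma bilDl x y z : bil (x + y) z = bil x z + bil y z.
Proof. by rewrite /Defs.bil !mulmxDl mxE. Qed.

Lemma bilDr x y z : bil x (y + z) = bil x y + bil x z.
Proof. by rewrite /Defs.bil linearD mulmxDr mxE. Qed.

Lemma bilZl a x y : bil (a *: x) y = a * bil x y.
Proof. by rewrite /Defs.bil -!scalemxAl mxE. Qed.

Lemma bilZr a x y : bil x (a *: y) = a * bil x y.
Proof. by rewrite /Defs.bil linearZ -scalemxAr mxE. Qed.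

Lemma bilNl x y : bil (- x) y = - bil x y.
Proof. by rewrite -scaleN1r bilZl mulN1r. Qed.

Lemma bilNr x y : bil x (- y) = - bil x y.
Proof. by rewrite -scaleN1r bilZr mulN1r. Qed.

Lemma bilBl x y z : bil (x - y) z = bil x z - bil y z.
Proof. by rewrite bilDl bilNl. Qed.

Lemma bilBr x y z : bil x (y - z) = bil x y - bil x z.
Proof. by rewrite bilDr bilNr. Qed.

Lemma bil0l y : bil 0 y = 0.
Proof. by rewrite -(scale0r 0) bilZl mul0r. Qed.

Lemma bil0r y : bil y 0 = 0.
Proof. by rewrite -(scale0r 0) bilZr mul0r. Qed.

Lemma bil_suml (I : Type) (r : seq I) (P : pred I) (v : I -> V) y :
  bil (\sum_(k <- r | P k) v k) y = \sum_(k <- r | P k) bil (v k) y.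
Proof.
by apply: (big_morph (fun x => bil x y)); [move=> *; apply: bilDl | apply: bil0l].
Qed.

Lemma bil_sumr (I : Type) (r : seq I) (P : pred I) (v : I -> V) y :
  bil y (\sum_(k <- r | P k) v k) = \sum_(k <- r | P k) bil y (v k).
Proof.
by apply: (big_morph (fun x => bil y x)); [move=> *; apply: bilDr | apply: bil0r].
Qed.

Lemma bilC x y : bil x y = bil y x.
Proof.
have gT : (gram iota q)^T = gram iota q.
  by apply/matrixP => i j; rewrite !mxE polarC.
have E : x *m gram iota q *m y^T = (y *m gram iota q *m x^T)^T.
  by rewrite !trmx_mul trmxK gT mulmxA.
by rewrite /Defs.bil E mxE.
Qed.

Lemma qVD x y : qV (x + y) = qV x + qV y + 2 * bil x y.
Proof. by rewrite /Defs.qV !bilDl !bilDr (bilC y x); ring. Qed.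

Lemma qVZ a x : qV (a *: x) = a ^+ 2 * qV x.
Proof. by rewrite /Defs.qV bilZl bilZr; ring. Qed.

Lemma qVB x y : qV (x - y) = qV x + qV y - 2 * bil x y.
Proof. by rewrite qVD bilNr -scaleN1r qVZ; ring. Qed.

Lemma bil_map (x y : 'rV[A]_n) :
  bil (map_mx iota x) (map_mx iota y) = iota (polar q x y) / 2.
Proof.
rewrite polar_expand // rmorph_sum mulr_suml /Defs.bil mxE.
under eq_bigr do rewrite mxE mulr_suml.
rewrite exchange_big; apply: eq_bigr => i _.
rewrite rmorph_sum mulr_suml; apply: eq_bigr => j _.
by rewrite !mxE !rmorphM; ring.
Qed.

Lemma qV_map (x : 'rV[A]_n) : qV (map_mx iota x) = iota (q x).
Proof.
by rewrite /Defs.qV bil_map quadratic_form_polarxx // rmorphM rmorph_nat mulrC mulKf.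
Qed.

Definition is_submod (N : set V) : Prop :=
  N 0 /\ forall a x y, N x -> N y -> N (iota a *: x + y).

Section Submod.
Variable N : set V.
Hypothesis sN : is_submod N.

Lemma submodD x y : N x -> N y -> N (x + y).
Proof. by move=> Nx Ny; have := sN.2 1 _ _ Nx Ny; rewrite rmorph1 scale1r. Qed.

Lemma submodZ a x : N x -> N (iota a *: x).
Proof. by move=> Nx; have := sN.2 a _ _ Nx sN.1; rewrite addr0. Qed.

Lemma submodN x : N x -> N (- x).
Proof. by move=> Nx; have := submodZ (-1) Nx; rewrite rmorphN1 scaleN1r. Qed.

Lemma submodB x y : N x -> N y -> N (x - y).
Proof. by move=> Nx Ny; apply: submodD => //; apply: submodN. Qed.

Lemma submod_sum (I : Type) (r : seq I) (P : pred I) (v : I -> V) :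
  (forall k, P k -> N (v k)) -> N (\sum_(k <- r | P k) v k).
Proof. by move=> H; apply: big_ind => //; [apply: sN.1 | apply: submodD]. Qed.

Lemma submod_pA m a x : pA m a -> N (2 ^+ m *: x) -> N (a *: x).
Proof. by move=> [b ->] Nx; rewrite mulrC -scalerA; apply: submodZ. Qed.

Lemma submod_mulmx r (a : 'M[A]_(r, n)) (c : 'rV[A]_r) :
  (forall s, N (map_mx iota (row s a))) -> N (map_mx iota (c *m a)).
Proof.
move=> Na; rewrite mulmx_sum_row raddf_sum /=; apply: submod_sum => s _.
by rewrite map_mxZ; apply: submodZ.
Qed.

End Submod.

Lemma latL_submod : is_submod latL.
Proof.
split; first by exists 0; rewrite map_mx0.
by move=> a _ _ [x ->] [y ->]; exists (a *: x + y); rewrite map_mxD map_mxZ.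
Qed.

Lemma pA_lin i a x y z : pA i (bil x z) -> pA i (bil y z) ->
  pA i (bil (iota a *: x + y) z).
Proof.
by move=> xz yz; rewrite bilDl bilZl; apply: pAD => //; apply: pA_scale.
Qed.

Lemma latA_submod i : is_submod (latA i).
Proof.
split=> [|a x y [xL xb] [yL yb]].
  by split=> [|y _]; [apply: latL_submod.1 | rewrite bil0l; apply: pA0].
split; first exact: latL_submod.2.
by move=> z zL; apply: pA_lin; auto.
Qed.

Lemma latA_le i j x : (i <= j)%N -> latA j x -> latA i x.
Proof. by move=> ij [xL xb]; split=> // y yL; apply: pA_le ij _; apply: xb. Qed.

Lemma latA_pow2 m i x : latA i x -> latA (m + i) (2 ^+ m *: x).
Proof.
move=> [xL xb]; split=> [|y yL]; last by rewrite bilZl; apply: pAM (pA_pow2 _ _) _; apply: xb.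
have := submodZ latL_submod (2 ^+ m) xL.
by rewrite rmorphXn rmorph_nat.
Qed.

(** This is X_i ∩ Z_i freed of implied conditions: pairing with all of A_i into 2^(i+1) A and q(x)
    in 2^(i+2) A already force x into B_i and Y_i. *)
Definition lat_deep i : set V :=
  [set x | [/\ latA i x, forall y, latA i y -> pA i.+1 (bil x y) & pA i.+2 (qV x)]].

Lemma lat_deep_submod i : is_submod (lat_deep i).
Proof.
split.
  split; first exact: (latA_submod i).1.
    by move=> y _; rewrite bil0l; apply: pA0.
  by rewrite /Defs.qV bil0l; apply: pA0.
move=> a x y [xA xb xq] [yA yb yq]; split; first exact: (latA_submod i).2.
  by move=> z zA; apply: pA_lin; auto.
rewrite qVD qVZ bilZl; apply: pAD.
  by apply: pAD => //; rewrite -rmorphXn; apply: pA_scale.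
by apply/pA_2M => //; apply: pA_scale; apply: xb.
Qed.

Lemma lat_deep_sub i x : lat_deep i x -> (latX i `&` latZ i) x.
Proof.
move=> [xA xb xq]; split=> //; split=> //; split=> [|y [yA _]]; last exact: xb.
by split=> //; apply: pA_le xq.
Qed.

Lemma latB_submod i : is_submod (latB i).
Proof.
split=> [|a x y [xA xq] [yA yq]].
  by split; [apply: (latA_submod i).1 | rewrite /Defs.qV bil0l; apply: pA0].
split; first exact: (latA_submod i).2.
rewrite qVD qVZ bilZl; apply: pAD.
  by apply: pAD => //; rewrite -rmorphXn; apply: pA_scale.
by apply/pA_2M => //; apply: pA_scale; apply: xA.2; apply: yA.1.
Qed.

Lemma latX_submod i : is_submod (latX i).
Proof.
split=> [|a x y [xA xb] [yA yb]].
  by split=> [|y _]; [apply: (latA_submod i).1 | rewrite bil0l; apply: pA0].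
split; first exact: (latA_submod i).2.
by move=> z zA; apply: pA_lin; auto.
Qed.

(** * Integral self-adjoint involutions as points of G(A) *)

Section Isometry.
Variable s : 'M[A]_n.
Local Notation S := (map_mx iota s).
Hypothesis sinv : S *m S = 1%:M.
Hypothesis sadj : forall x y, bil (x *m S) y = bil x (y *m S).

Let sigmaK x : x *m S *m S = x. Proof. by rewrite -mulmxA sinv mulmx1. Qed.

Lemma isom_bil x y : bil (x *m S) (y *m S) = bil x y.
Proof. by rewrite sadj sigmaK. Qed.

Lemma isom_qV x : qV (x *m S) = qV x.
Proof. exact: isom_bil. Qed.

Lemma isom_latL x : latL x -> latL (x *m S).
Proof. by move=> [y ->]; exists (y *m s); rewrite map_mxM. Qed.

Lemma isom_latA i x : latA i x -> latA i (x *m S).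
Proof.
by move=> [xL xb]; split=> [|y yL]; [| rewrite sadj; apply: xb]; apply: isom_latL.
Qed.

Lemma isom_latX i x : latX i x -> latX i (x *m S).
Proof.
by move=> [xL xb]; split=> [|y yL]; [| rewrite sadj; apply: xb]; apply: isom_latA.
Qed.

Lemma isom_latB i x : latB i x -> latB i (x *m S).
Proof. by move=> [xA xq]; split; [apply: isom_latA | rewrite isom_qV]. Qed.

Lemma isom_latY i x : latY i x -> latY i (x *m S).
Proof.
by move=> [xL xb]; split=> [|y yL]; [| rewrite sadj; apply: xb]; apply: isom_latB.
Qed.

Lemma isom_latZ i x : latZ i x -> latZ i (x *m S).
Proof. by move=> [xA xq]; split; [apply: isom_latY | rewrite isom_qV]. Qed.

Lemma isom_latW i x : latW i x -> latW i (x *m S).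
Proof.
move=> [xA [e [a [[eA ev] xe]]]]; split; first exact: isom_latA.
exists (e *m S), a; split; last by rewrite scalemxAl -mulmxBl; apply: isom_latX.
split=> [|v vA]; first exact: isom_latA.
by rewrite -sadj -(isom_qV v); apply/ev/isom_latA.
Qed.

(** Automatic for an isometry S, because q(xS - x) = 2(q(x) - <xS, x>). *)
Lemma isom_sub1_latA i x : latA i x -> latB i (x *m S - x).
Proof.
move=> xA; split; first by apply: (submodB (latA_submod i)) => //; apply: isom_latA.
rewrite (_ : qV _ = 2 * (qV x - bil (x *m S) x)); last by rewrite qVB isom_qV; ring.
apply/pA_2M => //.
by apply: pAB; [apply: xA.2; apply: xA.1 | apply: (isom_latA xA).2; apply: xA.1].
Qed.

Lemma lat_maps_id (m : 'M[A]_n) (N N' : set V) :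
  (forall x, N x -> N' (x *m map_mx iota m)) ->
  lat_maps iota idfun m N N'.
Proof.
move=> NN' k _ _ x [t [c [y [yN ->]]]]; exists t, c, (y *m m).
split=> [u|]; last by rewrite map_mxM !map_mx_id // mulmxA.
have [z [zN yz]] := yN u; exists (z *m map_mx iota m); split; first exact: NN'.
by rewrite row_mul map_mxM yz scalemxAl.
Qed.

(** The lattices are defined from q, hence stable under S. Of the conditions on s - 1, the one on
    A_i is automatic, and the one on dual lattices follows by adjunction from the one on W_i, since
    <xS - x, w> = <x, wS - w>. *)
Lemma isom_in_G :
  (forall i x, latW i x -> (latX i `&` latZ i) (x *m S - x)) ->
  in_G iota q idfun s.
Proof.
move=> sW.
have subS x : x *m map_mx iota (s - 1%:M) = x *m S - x.
  by rewrite map_mxB map_mx1 mulmxBr mulmx1.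
split; first split.
- move=> i; split.
    split; [| | | |split]; apply: lat_maps_id.
    + exact: isom_latA. + exact: isom_latB. + exact: isom_latW.
    + exact: isom_latX. + exact: isom_latY. + exact: isom_latZ.
  split; apply: lat_maps_id => x xN; rewrite subS.
  + exact: isom_sub1_latA. + exact: sW.
  move=> w wW; rewrite bilBl sadj -bilBr; apply: xN; exact: sW.
- exists (\det s); rewrite -det_mulmx.
  have -> : s *m s = 1%:M.
    by apply: (map_iota_inj iota_inj); rewrite map_mxM map_mx1.
  by rewrite det1.
move=> x.
have reg2 := integers_reg2 iota_inj two_neq0.
have idE (y : 'rV[A]_n) : qf_base idfun q y = q y.
  by have := qf_base_map qf reg2 idfun y; rewrite map_mx_id.
rewrite !idE; apply: iota_inj.
by rewrite -!qV_map map_mxM isom_qV.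
Qed.

End Isometry.

(** * Alternating forms of odd rank modulo 2 *)

Hypothesis two_nunit : ~ exists a : A, 2 * a = 1.
Hypothesis local_unit : forall a : A, (exists b, a = 2 * b) \/ (exists b, a * b = 1).
Hypothesis perfect : forall a : A, exists b c, a = b ^+ 2 + 2 * c.

Lemma even_unitF (a b : A) : a * b = 1 -> ~ exists c, a = 2 * c.
Proof.
by move=> ab [c ac]; apply: two_nunit; exists (c * b); rewrite mulrA -ac.
Qed.

Lemma skew_odd_det0 r (M : 'M[A]_r) : M^T = - M -> odd r -> \det M = 0.
Proof.
move=> Mskew ro; apply: (integers_reg2 iota_inj two_neq0).
have : \det M = - \det M.
  by rewrite -{1}det_tr Mskew -scaleN1r detZ -signr_odd ro expr1 mulN1r.
by rewrite mulr0 mulr_natl mulr2n => {1}->; rewrite addNr.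
Qed.

(* An alternating form mod 2 lifts to a skew-symmetric one over A, whose
   determinant vanishes in odd rank. *)
Lemma alternating_mod2_kernel r (M : 'M[A]_r) :
  (forall s, exists b, M s s = 2 * b) -> M^T = M -> odd r ->
  exists c : 'rV[A]_r, (forall t, exists b, (c *m M) 0 t = 2 * b) /\
    ~ forall s, exists b, c 0 s = 2 * b.
Proof.
move=> Mdiag Msym ro.
have two_max (a : A) : (exists b, a = 2 * b) \/ (exists b d, a * b = 1 + 2 * d).
  have [|[b ab]] := local_unit a; [by left | right].
  by exists b, 0; rewrite mulr0 addr0.
have [k [p [psurj pker]]] := residue_field_exists two_nunit two_max.
have p2 : p 2 = 0 by apply/pker; exists 1; rewrite mulr1.
have pN a : p (- a) = p a.
  apply/eqP; rewrite -subr_eq0 -rmorphB -opprD -mulr2n -mulr_natl rmorphN rmorphM.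
  by rewrite p2 mul0r oppr0.
pose M' : 'M[A]_r := \matrix_(s, t)
  if (s < t)%N then M s t else if (t < s)%N then - M s t else 0.
have M'skew : M'^T = - M'.
  apply/matrixP => s t; rewrite !mxE; case: ltngtP => _; rewrite ?oppr0 ?opprK //.
    by rewrite -[in LHS]Msym mxE.
  by rewrite -[in LHS]Msym mxE.
have pM : map_mx p M = map_mx p M'.
  apply/matrixP => s t; rewrite !mxE; case: ltngtP => // st; rewrite ?pN //.
  by rewrite (val_inj st) rmorph0; apply/pker.
have /eqP/det0P[v v0 vM] : \det (map_mx p M) = 0.
  by rewrite pM det_map_mx skew_odd_det0 // rmorph0.
have /choice[c cP] : forall s, exists a, p a = v 0 s by move=> s; apply: psurj.
have cv : map_mx p (\row_s c s) = v by apply/rowP => s; rewrite !mxE.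
exists (\row_s c s); split=> [t|ce].
  by apply/pker; have /rowP/(_ t) := vM; rewrite -cv -map_mxM !mxE.
case/eqP: v0; apply/rowP => s; rewrite -cP mxE; apply/pker.
by have [b] := ce s; rewrite mxE; exists b.
Qed.

Lemma latY_exists_odd i : (exists r, quot_dim iota (latB i) (latZ i) r /\ odd r) ->
  exists y, latY i y /\ ~ pA i.+2 (qV y).
Proof.
move=> [r [[a [aB agen aind]] ro]]; apply: contrapT => /forallNP H.
have YZ y : latY i y -> latZ i y.
  by move=> yY; split=> //; apply: contrapT => yq; apply: (H y).
pose b s := map_mx iota (row s a).
have /choice[m mP] : forall st : 'I_r * 'I_r, exists c, bil (b st.1) (b st.2) / 2 ^+ i = iota c.
  move=> [s t]; have [c] : pA 0 (bil (b s) (b t) / 2 ^+ i).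
    by apply/(pA_div0 _ two_neq0 i); apply: (aB s).1.2; apply: (aB t).1.1.
  by rewrite mul1r; exists c.
have mE s t : bil (map_mx iota (row s a)) (map_mx iota (row t a)) / 2 ^+ i = iota (m (s, t)).
  exact: (mP (s, t)).
pose M := \matrix_(s, t) m (s, t).
have Mdiag s : exists c, M s s = 2 * c.
  apply/(pA1P iota_inj); rewrite mxE -mE.
  by apply/(pA_div1 _ two_neq0 i); apply: (aB s).2.
have Msym : M^T = M.
  by apply/matrixP => s t; rewrite !mxE; apply: iota_inj; rewrite -!mE bilC.
(* The Gram matrix M has even diagonal because q is divisible by 2^(i+1) on B_i. A kernel vector
   modulo 2 gives an element of Y_i, contained in Z_i by assumption, so independence modulo Z_i
   makes its coefficients even. *)
have [c [cM]] := alternating_mod2_kernel Mdiag Msym ro; apply; apply: aind; apply: YZ.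
have xB : latB i (map_mx iota (c *m a)) by apply: (submod_mulmx (latB_submod i)).
split=> // y yB; have [d dZ] := agen y yB.
rewrite -[y](subrK (map_mx iota (d *m a))) bilDr; apply: pAD.
  by rewrite bilC; apply: dZ.1.2.
rewrite (mulmx_sum_row d) raddf_sum /= bil_sumr; apply: pA_sum => t _.
rewrite map_mxZ bilZr; apply: pA_scale; apply/(pA_div1 _ two_neq0 i).
rewrite (_ : _ / _ = iota ((c *m M) 0 t)); first by apply/(pA1P iota_inj); apply: cM.
rewrite (mulmx_sum_row c) raddf_sum /= bil_suml mulr_suml mxE rmorph_sum.
by apply: eq_bigr => s _; rewrite map_mxZ bilZl -mulrA mE rmorphM mxE.
Qed.

Lemma even_sqr (a b : A) : a ^+ 2 = 2 * b -> exists c, a = 2 * c.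
Proof.
move=> ab; have [//|[a' aa']] := local_unit a; case: two_nunit.
by exists (b * a' ^+ 2); rewrite mulrA -ab -exprMn aa' expr1n.
Qed.

(** On B_i the congruence defining e makes the square of 2^-i <v, e> even, and an element with even
    square is even. *)
Lemma is_e_bil_even i e v : is_e iota q i e -> latA i v -> pA i.+1 (qV v) ->
  pA i.+1 (bil v e).
Proof.
move=> [eA ev] vA vq.
have [a Ea] : pA 0 (bil v e / 2 ^+ i).
  by apply/(pA_div0 _ two_neq0 i); apply: vA.2; apply: eA.1.
rewrite mul1r in Ea; apply/(pA_div1 _ two_neq0 i); rewrite Ea.
apply/pA1P => //; have : pA 1 (iota a ^+ 2).
  rewrite -[_ ^+ 2](subrK (qV v / 2 ^+ i)); apply: pAD; first by rewrite -Ea; apply: ev.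
  exact/(pA_div1 _ two_neq0 i).
by rewrite -rmorphXn => /(pA1P iota_inj)[b /even_sqr].
Qed.

(** * Jordan splittings and characteristic vectors *)

Section Jordan.
Variables (J : nat -> set V) (rk : nat -> nat).
Hypothesis JS : jordan_splitting iota q J rk.

Lemma jordan_submod i : is_submod (J i).
Proof.
have [b [-> _ _]] := jordan_basis JS i; split.
  by exists 0; rewrite mul0mx map_mx0.
move=> a _ _ [c ->] [d ->]; exists (a *: c + d).
by rewrite mulmxDl -scalemxAl map_mxD map_mxZ.
Qed.

Lemma jordan_latL i x : J i x -> latL x.
Proof.
by have [b [-> _ _]] := jordan_basis JS i => -[c ->]; exists (c *m b).
Qed.

Lemma jordan_bilJ i x y : J i x -> J i y -> pA i (bil x y).
Proof.
have [b [-> _ [U [_ bU]]]] := jordan_basis JS i => -[c ->] [d ->].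
rewrite !mulmx_sum_row !raddf_sum /= bil_suml; apply: pA_sum => s _.
rewrite bil_sumr; apply: pA_sum => t _.
rewrite !map_mxZ bilZl bilZr; do 2!apply: pA_scale.
by apply/(pA_div0 _ two_neq0 i); rewrite bU; apply: pA_iota.
Qed.

Lemma jordan_bil_sum i N (c : nat -> V) x : (forall j, J j (c j)) -> J i x ->
  bil (\sum_(j < N) c j) x = if (i < N)%N then bil (c i) x else 0.
Proof.
move=> cJ xJ; rewrite bil_suml; case: ltnP => iN.
  rewrite (bigD1 (Ordinal iN)) //= big1 ?addr0 // => j; rewrite -val_eqE /= => /eqP ji.
  exact: (jordan_orthogonal JS ji).
rewrite big1 // => j _; apply: (jordan_orthogonal JS) (cJ j) xJ => ji.
by have := ltn_ord j; rewrite ji ltnNge iN.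
Qed.

Lemma jordan_latA i x : J i x -> latA i x.
Proof.
move=> xJ; split=> [|y yL]; first exact: jordan_latL xJ.
have [N [c [cJ ->]]] := jordan_sum JS yL.
rewrite bilC (jordan_bil_sum _ cJ xJ); case: ifP => _; last exact: pA0.
exact: jordan_bilJ.
Qed.

(** The coordinates of x are recovered from its pairings with the basis by the inverse Gram matrix
    [u *: \adj U], where u inverts the determinant; divisibility of the pairings thus passes to the
    coordinates. *)
Lemma jordan_unimodular i m x : J i x ->
  (forall y, J i y -> pA (i + m) (bil x y)) ->
  exists y, J i y /\ x = 2 ^+ m *: y.
Proof.
have [b [JE _ [U [[u Uu] bU]]]] := jordan_basis JS i.
have bJ s : J i (map_mx iota (row s b)).
  by rewrite JE; exists (delta_mx 0 s); rewrite -rowE.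
rewrite {1}JE => -[c ->] xb.
have /choice[d dP] : forall s, exists a, (c *m U) 0 s = 2 ^+ m * a.
  move=> s; have [a Ea] : pA m (bil (map_mx iota (c *m b)) (map_mx iota (row s b)) / 2 ^+ i).
    by apply/(pA_div _ two_neq0); apply: xb.
  exists a; apply: iota_inj; rewrite rmorphM rmorphXn rmorph_nat -Ea.
  rewrite (mulmx_sum_row c b) raddf_sum /= bil_suml mulr_suml mxE rmorph_sum.
  by apply: eq_bigr => t _; rewrite map_mxZ bilZl -mulrA bU rmorphM.
exists (map_mx iota ((u *: (\row_s d s *m \adj U)) *m b)); split.
  by rewrite JE; exists (u *: (\row_s d s *m \adj U)).
have cE : c = 2 ^+ m *: (u *: (\row_s d s *m \adj U)).
  have E : 2 ^+ m *: \row_s d s = c *m U by apply/rowP => s; rewrite !mxE -dP mxE.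
  rewrite scalerA mulrC -scalerA scalemxAl E -mulmxA mul_mx_adj mul_mx_scalar scalerA.
  by rewrite mulrC Uu scale1r.
by rewrite {1}cE -scalemxAl map_mxZ rmorphXn rmorph_nat.
Qed.

Lemma type_II_even i x : ~ type_I iota q J i -> J i x -> pA i.+1 (qV x).
Proof.
move=> nI xJ; have [a Ea] : pA 0 (qV x / 2 ^+ i).
  by apply/(pA_div0 _ two_neq0 i); apply: jordan_bilJ.
rewrite mul1r in Ea; apply/(pA_div1 _ two_neq0 i); rewrite Ea.
apply/pA1P => //; have [//|ua] := local_unit a.
by case: nI; exists x, a.
Qed.

Definition lat_rest i : set V :=
  [set x | latA i x /\ forall y, J i y -> bil x y = 0].

Lemma lat_rest_submod i : is_submod (lat_rest i).
Proof.
split=> [|a x y [xA xJ] [yA yJ]].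
  by split=> [|y _]; [apply: (latA_submod i).1 | rewrite bil0l].
split=> [|z zJ]; first exact: (latA_submod i).2.
by rewrite bilDl bilZl xJ // yJ // mulr0 addr0.
Qed.

Lemma latA_split i x : latA i x -> exists y z, [/\ x = y + z, J i y & lat_rest i z].
Proof.
move=> xA; have [N [c [cJ Ex]]] := jordan_sum JS xA.1.
pose y := if (i < N)%N then c i else 0.
have yJ : J i y by rewrite /y; case: ifP => _; last exact: (jordan_submod i).1.
exists y, (x - y); split=> //; first by rewrite addrC subrK.
split=> [|z zJ]; first by apply: (submodB (latA_submod i)) => //; apply: jordan_latA.
rewrite bilBl Ex (jordan_bil_sum _ cJ zJ) /y; case: ifP => _; first exact: subrr.
by rewrite bil0l subrr.
Qed.

(** Each component c_j contributes q(c_j). For j >= i+2 this lies in 2^j A; for j < i unimodularity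
    gives c_j = 2^(i-j) z, and 2(i-j) + j >= i+2 once i-j >= 2. At j = i+1 and j = i-1 one factor 2
    is missing, and type II supplies it. *)
Lemma lat_rest_qV i x : free_at iota q J i -> lat_rest i x -> pA i.+2 (qV x).
Proof.
move=> fr [xA xJ]; have [N [c [cJ Ex]]] := jordan_sum JS xA.1.
have xc j (jN : (j < N)%N) y : J j y -> bil x y = bil (c j) y.
  by move=> yJ; rewrite Ex (jordan_bil_sum _ cJ yJ) jN.
rewrite /Defs.qV {2}Ex bil_sumr; apply: pA_sum => j _.
have [ij|ij|ij] := ltngtP i j.
- rewrite (xc _ (ltn_ord j)) //.
  move: ij; rewrite leq_eqVlt => /orP[/eqP ij|ij]; last first.
    by apply: pA_le ij _; apply: jordan_bilJ.
  by rewrite ij; apply: type_II_even => //; apply: fr; right.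
- have [z [zJ cz]] : exists z, J j z /\ c j = 2 ^+ (i - j) *: z.
    apply: jordan_unimodular => // y yJ; rewrite subnKC ?(ltnW ij) //.
    by rewrite -(xc _ (ltn_ord j)) //; apply: xA.2; apply: jordan_latL yJ.
  rewrite (xc _ (ltn_ord j)) // -/(Defs.qV iota q (c j)) cz qVZ.
  rewrite -exprM; set m := (i - j)%N.
  have ijm : i = (m + j)%N by rewrite subnK // ltnW.
  have m0 : (0 < m)%N by rewrite subn_gt0.
  move: m0; rewrite leq_eqVlt => /orP[/eqP m1|m1].
    have -> : i.+2 = (m * 2 + j.+1)%N by rewrite ijm -m1.
    apply/pA_pow2M => //; apply: type_II_even => //; apply: fr; left.
    by rewrite ijm -m1.
  apply: (@pA_le _ _ _ _ (m * 2 + j)).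
    by move: ijm m1; clearbody m; lia.
  by apply/pA_pow2M => //; apply: jordan_bilJ.
by rewrite xJ //; [apply: pA0 | rewrite ij].
Qed.

(** So the complement of a free J_i lies in X_i: only the complementary part of y pairs with x, and
    polarizing the previous bound by 2^(i+2) costs one factor 2. *)
Lemma lat_rest_bil i x y : free_at iota q J i -> lat_rest i x -> latA i y ->
  pA i.+1 (bil x y).
Proof.
move=> fr xr /latA_split[y1 [y2 [-> y1J y2r]]].
rewrite bilDr xr.2 // add0r; apply/(pA_2M iota two_neq0).
have -> : 2 * bil x y2 = qV (x + y2) - qV x - qV y2 by rewrite qVD; ring.
by do 2?apply: pAB; apply: (@lat_rest_qV i) => //; apply: (submodD (lat_rest_submod i)).
Qed.

(* A vector y of Y_i with 2^(-i-1) q(y) a unit has its J_i-component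
   orthogonal mod 2 to the kernel of 2^-i q mod 2, hence proportional to e. *)
Lemma characteristic_vector i : free_type_Ie1 iota q J rk i ->
  exists e u v, [/\ J i e, is_e iota q i e, u * v = 1 & qV e = 2 ^+ i.+1 * iota u].
Proof.
case=> fr [v0 [a0 [v0J [b0 a0b0] v0q]]] _ /latY_exists_odd[y [yY yq]].
have [y1 [z [yE y1J zr]]] := latA_split yY.1.1.
have y1A := jordan_latA y1J.
have zq := lat_rest_qV fr zr.
have y1q : qV y1 = qV y - qV z by rewrite yE qVD bilC zr.2 //; ring.
have [u1 u1E] : pA i.+1 (qV y1).
  by rewrite y1q; apply: pAB; [apply: yY.1.2 | apply: pA_le zq].
have y1odd : ~ pA i.+2 (qV y1).
  by move=> H; apply: yq; rewrite yE qVD bilC zr.2 // mulr0 addr0; apply: pAD.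
have [u1e|[t1 u1t1]] := local_unit u1.
  case: y1odd; rewrite u1E -addn1; apply/(pA_pow2M iota two_neq0).
  exact/(pA1P iota_inj).
have y1B v : latB i v -> pA i.+1 (bil v y1).
  move=> vB; have -> : bil v y1 = bil y v - bil z v by rewrite yE bilDl addrK bilC.
  by apply: pAB; [apply: yY.2 | apply: lat_rest_bil vB.1].
(* c0 is a square root modulo 2 of the inverse of a0 = 2^-i q(v0), so 2^-i q(v1) is 1 modulo 2. *)
have [c0 [d0 b0E]] := perfect b0.
pose v1 := iota c0 *: v0.
have v1J : J i v1 by apply: (submodZ (jordan_submod i)).
have v1A := jordan_latA v1J.
have [w wE] : pA 0 (bil v1 y1 / 2 ^+ i).
  by apply/(pA_div0 _ two_neq0 i); apply: jordan_bilJ.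
rewrite mul1r in wE.
(* With a a square root of 2^-i q(v) modulo 2, the vector v - a v1 lies in B_i, where pairing with
   y1 is even; hence 2^-i <v, y1> is a w modulo 2. *)
have approx v : latA i v -> exists a s : A,
    pA 1 (iota a ^+ 2 - qV v / 2 ^+ i) /\ bil v y1 / 2 ^+ i = iota (a * w + 2 * s).
  move=> vA; have [b bE] : pA 0 (qV v / 2 ^+ i).
    by apply/(pA_div0 _ two_neq0 i); apply: vA.2; apply: vA.1.
  rewrite mul1r in bE; have [a [c bac]] := perfect b.
  have [h hE] : pA 0 (bil v v1 / 2 ^+ i).
    by apply/(pA_div0 _ two_neq0 i); apply: vA.2; apply: v1A.1.
  rewrite mul1r in hE.
  have xB : latB i (v - iota a *: v1).
    split.
      by apply: (submodB (latA_submod i)) => //; apply: (submodZ (latA_submod i)).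
    apply/(pA_div1 _ two_neq0 i); rewrite qVB !qVZ bilZr.
    have -> : (qV v + iota a ^+ 2 * (iota c0 ^+ 2 * qV v0) - 2 * (iota a * bil v v1)) / 2 ^+ i
            = qV v / 2 ^+ i + iota a ^+ 2 * (iota c0 ^+ 2 * (qV v0 / 2 ^+ i)) - 2 * (iota a * (bil v v1 / 2 ^+ i)).
      by ring.
    rewrite bE v0q hE; exists (c + a ^+ 2 - a ^+ 2 * d0 * a0 - a * h).
    have c0a0 : c0 ^+ 2 * a0 = a0 * b0 - 2 * d0 * a0 by rewrite b0E; ring.
    rewrite a0b0 in c0a0.
    have E0 : iota c0 ^+ 2 * iota a0 = 1 - 2 * iota d0 * iota a0.
      by rewrite -rmorphXn -rmorphM c0a0 rmorphB !rmorphM rmorph_nat rmorph1.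
    rewrite E0 bac !rmorphB !rmorphD !rmorphM ?rmorphXn ?rmorph_nat; ring.
  have /(pA_div1 _ two_neq0 i)[s sE] := y1B _ xB.
  exists a, s; split.
    rewrite bE -rmorphXn -rmorphB; apply/(pA1P iota_inj); exists (- c).
    by rewrite bac; ring.
  have -> : bil v y1 / 2 ^+ i = bil (v - iota a *: v1) y1 / 2 ^+ i + iota a * (bil v1 y1 / 2 ^+ i).
    by rewrite bilBl bilZl; ring.
  by rewrite sE wE expr1 rmorphD !rmorphM rmorph_nat; ring.
(* If w were even, y1 would pair evenly with J_i, so y1 = 2y' and q(y1) = 4q(y') would lie in
   2^(i+2) A. So w is a unit and y1/w represents e. *)
have [[w2 we]|[w' ww']] := local_unit w.
  have [y' [y'J y1E]] : exists y', J i y' /\ y1 = 2 ^+ 1 *: y'.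
    apply: (jordan_unimodular y1J) => v vJ; rewrite addn1 bilC.
    apply/(pA_div1 _ two_neq0 i).
    have [a [s [_ ->]]] := approx _ (jordan_latA vJ).
    by apply/(pA1P iota_inj); exists (a * w2 + s); rewrite we; ring.
  case: y1odd; rewrite y1E qVZ -exprM.
  by apply/(pA_pow2M iota two_neq0 2 i); apply: jordan_bilJ.
exists (iota w' *: y1), (w' ^+ 2 * u1), (w ^+ 2 * t1); split.
- exact: (submodZ (jordan_submod i)).
- split=> [|v vA]; first exact: (submodZ (latA_submod i)).
  have [a [s [aE vE]]] := approx _ vA.
  have -> : bil v (iota w' *: y1) / 2 ^+ i = iota (a + 2 * (s * w')).
    by rewrite bilZr -mulrA vE -rmorphM -[a in RHS]mulr1 -ww'; congr (iota _); ring.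
  have -> : iota (a + 2 * (s * w')) ^+ 2 - qV v / 2 ^+ i =
    (iota a ^+ 2 - qV v / 2 ^+ i) + iota (2 * (2 * a * s * w' + 2 * s ^+ 2 * w' ^+ 2)).
    by rewrite !rmorphD !rmorphM !rmorphD !rmorphM ?rmorph_nat ?rmorphXn; ring.
  by apply: pAD => //; apply/(pA1P iota_inj); exists (2 * a * s * w' + 2 * s ^+ 2 * w' ^+ 2).
- have -> : w' ^+ 2 * u1 * (w ^+ 2 * t1) = (w * w') ^+ 2 * (u1 * t1) by ring.
  by rewrite ww' u1t1 expr1n mulr1.
by rewrite qVZ u1E rmorphM rmorphXn; ring.
Qed.

(** * Reflections in characteristic vectors *)

Section Reflections.
Variables (alpha : nat) (idx : 'I_alpha -> nat) (e : 'I_alpha -> V).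
Variables (u v : 'I_alpha -> A) (w : 'I_alpha -> bool).
Hypothesis idx_inj : injective idx.
Hypothesis eJ : forall t, J (idx t) (e t).
Hypothesis eP : forall t, is_e iota q (idx t) (e t).
Hypothesis uv : forall t, u t * v t = 1.
Hypothesis qVe : forall t, qV (e t) = 2 ^+ (idx t).+1 * iota (u t).

(* 2 / q(e_t) for the selected t, and 0 otherwise *)
Definition refl_coef t : F := iota ((w t)%:R * v t) / 2 ^+ idx t.

(** The product of the selected reflections, expanded as a sum because their axes are mutually
    orthogonal. Vectors are rows, so [gram iota q *m (e t)^T *m e t] sends x to <x, e_t> e_t. *)
Definition refl_mx : 'M[F]_n :=
  1%:M - \sum_t refl_coef t *: (gram iota q *m (e t)^T *m e t).

Lemma refl_mxE x :
  x *m refl_mx = x - \sum_t (refl_coef t * bil x (e t)) *: e t.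
Proof.
rewrite mulmxBr mulmx1 mulmx_sumr; congr (_ - _); apply: eq_bigr => t _.
by rewrite -scalemxAr !mulmxA [x *m _ *m _]mx11_scalar mul_scalar_mx scalerA //.
Qed.

Lemma refl_coef_qV t : refl_coef t * qV (e t) = 2 * (w t)%:R.
Proof.
have /(congr1 iota) := uv t; rewrite rmorphM rmorph1 => E.
transitivity (2 * (w t)%:R * (iota (u t) * iota (v t))); last by rewrite E mulr1.
by rewrite qVe /refl_coef exprS rmorphM rmorph_nat; field; rewrite pow2_neq0.
Qed.

Lemma refl_mx_J t x : J (idx t) x ->
  x *m refl_mx = x - (refl_coef t * bil x (e t)) *: e t.
Proof.
move=> xJ; rewrite refl_mxE (bigD1 t) //= big1 ?addr0 // => t' tt'.
rewrite (jordan_orthogonal JS _ xJ (eJ t')) ?mulr0 ?scale0r // => /idx_inj E.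
by rewrite E eqxx in tt'.
Qed.

Lemma refl_mx_e t : e t *m refl_mx = (1 - 2 * (w t)%:R) *: e t.
Proof. by rewrite (refl_mx_J (eJ t)) -/(qV (e t)) refl_coef_qV scalerBl scale1r. Qed.

Lemma refl_mx_inv : refl_mx *m refl_mx = 1%:M.
Proof.
apply/row_matrixP => k; rewrite !rowE mulmx1 mulmxA; set x := delta_mx 0 k.
rewrite [x *m refl_mx]refl_mxE mulmxBl mulmx_suml refl_mxE -[RHS]subr0 -addrA -opprD.
congr (_ - _); rewrite -big_split big1 //= => t _.
rewrite -scalemxAl refl_mx_e scalerA -scalerDl.
(* The product vanishes because [refl_coef t] carries the factor w, which is 0 or 1. *)
rewrite (_ : _ + _ = 2 * bil x (e t) * (refl_coef t * (1 - (w t)%:R))); last by ring.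
by rewrite /refl_coef; case: (w t); rewrite ?subrr ?mul0r ?rmorph0 ?mulr0 ?mul0r ?mulr0 scale0r.
Qed.

Lemma refl_mx_adj x y : bil (x *m refl_mx) y = bil x (y *m refl_mx).
Proof.
rewrite !refl_mxE bilBl bilBr bil_suml bil_sumr; congr (_ - _).
by apply: eq_bigr => t _; rewrite bilZl bilZr (bilC y) ; ring.
Qed.

Lemma refl_mx_integral : exists s : 'M[A]_n, map_mx iota s = refl_mx.
Proof.
have refl_latL x : latL x -> latL (x *m refl_mx).
  move=> xL; rewrite refl_mxE; apply: (submodB latL_submod) => //.
  apply: (submod_sum latL_submod) => t _.
  have [a aE] : pA 0 (bil x (e t) / 2 ^+ idx t).
    by apply/(pA_div0 _ two_neq0 (idx t)); rewrite bilC; apply: (jordan_latA (eJ t)).2.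
  rewrite mul1r in aE; rewrite /refl_coef mulrAC -mulrA aE -rmorphM.
  by apply: (submodZ latL_submod); apply: jordan_latL (eJ t).
have /choice[r rP] : forall k : 'I_n, exists y : 'rV[A]_n, row k refl_mx = map_mx iota y.
  by move=> k; rewrite rowE; apply: refl_latL; exists (delta_mx 0 k); rewrite map_delta_mx.
exists (\matrix_k r k); apply/row_matrixP => k.
by rewrite rP -map_row rowK.
Qed.

(** The three numerical hypotheses serve in turn membership in A_i, the pairings with A_i, and q(2^m
    e_t), of valuation 2m + idx t + 1. *)
Lemma lat_deep_pow2 i m t : (i <= m + idx t)%N -> (0 < m)%N \/ (i < idx t)%N ->
  (i < m * 2 + idx t)%N -> lat_deep i (2 ^+ m *: e t).
Proof.
move=> H1 H2 H3; have eA := jordan_latA (eJ t); split.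
- by apply: latA_le H1 _; apply: latA_pow2.
- move=> y yA; rewrite bilZl.
  case: H2 => H2; last first.
    by apply: (@pA_le _ _ _ _ (m + idx t)); [lia | apply: pAM (pA_pow2 _ _) _; apply: eA.2; apply: yA.1].
  apply: (@pA_le _ _ _ _ (m + i)); first by lia.
  by apply: pAM (pA_pow2 _ _) _; rewrite bilC; apply: yA.2; apply: eA.1.
rewrite qVZ -exprM qVe; apply: (@pA_le _ _ _ _ (m * 2 + (idx t).+1)); first by lia.
by apply: pAM (pA_pow2 _ _) _; rewrite mulrC; apply: pA_scale; apply: pA_pow2.
Qed.

(** Put j = idx t and consider 2^-j <x, e_t>. For i < j it is integral and e_t is deep enough by
    itself; for i > j it is divisible by 2^(i-j) because x lies in A_i. For i = j a factor 2 is
    needed, and this is where W_i matters. *)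
Lemma refl_latW i x : latW i x -> lat_deep i (x *m refl_mx - x).
Proof.
move=> [xA [e' [a [e'P xe']]]].
rewrite refl_mxE addrAC subrr add0r; apply: (submodN (lat_deep_submod i)).
apply: (submod_sum (lat_deep_submod i)) => t _.
have -> : refl_coef t * bil x (e t) = iota ((w t)%:R * v t) * (bil x (e t) / 2 ^+ idx t).
  by rewrite /refl_coef; ring.
rewrite -scalerA; apply: (submodZ (lat_deep_submod i)).
have eA := jordan_latA (eJ t).
have [ij|ji|ij] := ltngtP i (idx t).
- apply: (@submod_pA _ (lat_deep_submod i) 0).
    by apply/(pA_div0 _ two_neq0 (idx t)); rewrite bilC; apply: eA.2; apply: xA.1.
  by apply: lat_deep_pow2; lia.
- apply: (@submod_pA _ (lat_deep_submod i) (i - idx t)).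
    apply/(pA_div _ two_neq0 (idx t)); rewrite subnKC ?(ltnW ji) //.
    by apply: xA.2; apply: eA.1.
  by apply: lat_deep_pow2; lia.
apply: (@submod_pA _ (lat_deep_submod i) 1); last by apply: lat_deep_pow2; lia.
rewrite -ij in eA *; apply/(pA_div1 _ two_neq0 i).
(* Modulo X_i the vector x is a multiple of e', and e_t lies in B_i because 2^-i q(e_t) is even, so
   <e', e_t> gains the factor 2. *)
rewrite -[x](subrK (iota a *: e')) bilDl bilZl; apply: pAD; first exact: xe'.2.
apply: pA_scale; rewrite bilC; apply: is_e_bil_even => //.
by rewrite qVe ij mulrC; apply: pA_scale; apply: pA_pow2.
Qed.

Lemma refl_in_G (s : 'M[A]_n) : map_mx iota s = refl_mx -> in_G iota q idfun s.
Proof.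
move=> sE; apply: isom_in_G; rewrite sE.
- exact: refl_mx_inv.
- exact: refl_mx_adj.
by move=> i x xW; apply: lat_deep_sub; apply: refl_latW.
Qed.

(** T is a matrix for the action of g on A_i/X_i: the image of a basis row is a B-combination of
    elements of A_i, each rewritten in the basis modulo X_i. *)
Lemma lat_maps_basis (B : comNzRingType) (f : {rmorphism A -> B}) (g : 'M[B]_n)
    i r (a : 'M[A]_(r, n)) :
  lat_maps iota f g (latA i) (latA i) -> quot_basis iota (latA i) (latX i) a ->
  exists T : 'M[B]_r, forall k,
    lat_base iota f (latX i) (row k (map_mx f a *m g - T *m map_mx f a)).
Proof.
move=> gA [aA agen _].
have scale0 : lat_scale 0 (latA i) `<=` latL.
  by move=> _ [y [yA ->]]; rewrite scale1r; apply: yA.1.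
suff /choice[T TP] : forall k, exists Tk : 'rV[B]_r,
    lat_base iota f (latX i) (row k (map_mx f a) *m g - Tk *m map_mx f a).
  by exists (\matrix_k T k) => k; rewrite raddfB /= !row_mul rowK.
move=> k; have [m [c [y [yA ->]]]] : lat_base iota f (lat_scale 0 (latA i)) (row k (map_mx f a) *m g).
  apply: gA => //; exists 1%N, 1%:M, (row k a); split; last by rewrite mul1mx map_row.
  move=> j; exists (map_mx iota (row k a)); rewrite scale1r; split=> //.
  by rewrite ord1 row_id.
have /choice[C CP] : forall j : 'I_m, exists C : 'rV[A]_r,
    latX i (map_mx iota (row j y) - map_mx iota (C *m a)).
  by move=> j; apply: agen; have [z [zA ->]] := yA j; rewrite scale1r.
exists (c *m map_mx f (\matrix_j C j)), m, c, (y - (\matrix_j C j) *m a).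
split=> [j|]; last by rewrite map_mxB map_mxM mulmxBr mulmxA.
by rewrite raddfB /= row_mul rowK map_mxB; apply: CP.
Qed.

(** For free L_i the complement of J_i in A_i lies in X_i, and unimodularity shows that an element
    of J_i in X_i lies in 2J_i. *)
Lemma jordan_quot_basis i (b : 'M[A]_(rk i, n)) : free_at iota q J i ->
  J i = [set x | exists c : 'rV[A]_(rk i), x = map_mx iota (c *m b)] ->
  (forall c : 'rV[A]_(rk i), c *m b = 0 -> c = 0) ->
  quot_basis iota (latA i) (latX i) b.
Proof.
move=> fr JE bfree.
have cJ c : J i (map_mx iota (c *m b)) by rewrite JE; exists c.
split=> [k|x /latA_split[y [z [-> yJ zr]]]|c [_ cX]].
- by apply: jordan_latA; rewrite rowE; apply: cJ.
- move: yJ; rewrite JE => -[c ->]; exists c; rewrite addrC addKr.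
  by split=> [|y' yA]; [apply: zr.1 | apply: lat_rest_bil yA].
have [y [yJ cy]] : exists y, J i y /\ map_mx iota (c *m b) = 2 ^+ 1 *: y.
  by apply: jordan_unimodular => // y yJ; rewrite addn1; apply: cX; apply: jordan_latA.
move: yJ; rewrite JE => -[d yd] k; exists (d 0 k).
suff /eqP: c - 2 *: d = 0 by rewrite subr_eq0 => /eqP ->; rewrite mxE.
apply: bfree; apply/eqP; rewrite mulmxBl subr_eq0; apply/eqP; apply: (map_iota_inj iota_inj).
by rewrite cy yd -scalemxAl map_mxZ rmorph_nat expr1.
Qed.

(** Even pairings with e_t would, by the congruence defining e, force even values of 2^-i q on J_i,
    against type I. *)
Lemma bil_e_odd t : type_I iota q J (idx t) ->
  ~ forall x, J (idx t) x -> pA (idx t).+1 (bil x (e t)).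
Proof.
set i := idx t => -[x [a [xJ [b ab] xq]]] even.
apply: (even_unitF ab); apply/(pA1P iota_inj); rewrite -xq.
have [c cE] : pA 1 (bil x (e t) / 2 ^+ i) by apply/(pA_div1 _ two_neq0 i); apply: even.
have -> : qV x / 2 ^+ i = (bil x (e t) / 2 ^+ i) ^+ 2 - ((bil x (e t) / 2 ^+ i) ^+ 2 - qV x / 2 ^+ i).
  by ring.
apply: pAB; last by apply: (eP t).2; apply: jordan_latA.
by rewrite cE; exists (2 * c ^+ 2); rewrite rmorphM rmorphXn rmorph_nat; ring.
Qed.

Lemma q_half_integral t x : latA (idx t) x ->
  pA 0 (q_half iota q (idx t) (fun y => bil y (e t) / 2 ^+ idx t) x).
Proof.
move=> xA; rewrite /q_half -[2 in X in _ / X]expr1.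
apply/(pA_div0 _ two_neq0 1).
have -> : qV x / 2 ^+ idx t + (bil x (e t) / 2 ^+ idx t) ^+ 2 =
    ((bil x (e t) / 2 ^+ idx t) ^+ 2 - qV x / 2 ^+ idx t) + 2 * (qV x / 2 ^+ idx t).
  by ring.
apply: pAD; first exact: (eP t).2.
apply/(pA_2M iota two_neq0); apply/(pA_div0 _ two_neq0 (idx t)).
by apply: xA.2; apply: xA.1.
Qed.

Lemma q_half_polar i x y z :
  q_half iota q i (fun y => bil y z / 2 ^+ i) (x + y)
  - q_half iota q i (fun y => bil y z / 2 ^+ i) x
  - q_half iota q i (fun y => bil y z / 2 ^+ i) y
  = bil x y / 2 ^+ i + bil x z / 2 ^+ i * (bil y z / 2 ^+ i).
Proof.
rewrite /q_half qVD bilDl; field.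
by rewrite pow2_neq0 // two_neq0.
Qed.

(** The invariance is exact, not only modulo 2: l = 2^-i <-, e_t> changes at most by a sign, and
    only its square enters. *)
Lemma refl_q_half t x :
  q_half iota q (idx t) (fun y => bil y (e t) / 2 ^+ idx t) (x *m refl_mx)
  = q_half iota q (idx t) (fun y => bil y (e t) / 2 ^+ idx t) x.
Proof.
rewrite /q_half /Defs.qV !refl_mx_adj -mulmxA refl_mx_inv mulmx1 refl_mx_e bilZr.
by case: (w t) => /=; congr (_ / 2); ring.
Qed.

Lemma q_half_quadratic t r (b : 'M[A]_(r, n)) (Q : 'rV[A]_r -> A) :
  (forall c, iota (Q c) = q_half iota q (idx t)
     (fun y => bil y (e t) / 2 ^+ idx t) (map_mx iota (c *m b))) ->
  quadratic_form Q.
Proof.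
move=> QE; split=> [a x|a x y z]; apply: iota_inj.
  rewrite QE rmorphM rmorphXn QE -scalemxAl map_mxZ /q_half qVZ bilZl.
  by ring.
have PE c d : iota (polar Q c d) =
    bil (map_mx iota (c *m b)) (map_mx iota (d *m b)) / 2 ^+ idx t +
    bil (map_mx iota (c *m b)) (e t) / 2 ^+ idx t *
    (bil (map_mx iota (d *m b)) (e t) / 2 ^+ idx t).
  by rewrite -q_half_polar /polar !rmorphB !QE mulmxDl map_mxD.
rewrite [RHS]rmorphD [X in _ = X + _]rmorphM !PE mulmxDl -scalemxAl map_mxD map_mxZ !bilDl !bilZl.
by ring.
Qed.

(** * Dickson invariants of the reflections *)

Section XiValue.
Variables (k : fieldType) (p : {rmorphism A -> k}).
Hypothesis p_surj : forall a, exists b, p b = a.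
Hypothesis p_ker : forall a, p a = 0 <-> exists b, a = 2 * b.

Lemma rank1_mod2 r (a : 'cV[A]_r) (b : 'rV[A]_r) :
  ~ (forall j, exists c, a j 0 = 2 * c) -> ~ (forall j, exists c, b 0 j = 2 * c) ->
  \rank (map_mx p a *m map_mx p b) = 1%N.
Proof.
move=> /existsNP[j1 a1] /existsNP[j2 b2]; apply/eqP; rewrite eqn_leq.
rewrite (leq_trans (mxrankM_maxl _ _)) ?rank_leq_col // lt0n mxrank_eq0.
apply/eqP => /matrixP/(_ j1 j2); rewrite !mxE big_ord_recl big_ord0 addr0 !mxE.
move=> /eqP; rewrite mulf_eq0 => /orP[] /eqP/p_ker.
  exact: a1.
exact: b2.
Qed.

Variables (B : comNzRingType) (f : {rmorphism A -> B}) (g : 'M[B]_n).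
Variables (psi : {rmorphism B -> A}) (s : 'M[A]_n).
Hypothesis psif : forall a, psi (f a) = a.
Hypothesis psig : map_mx psi g = s.
Hypothesis sE : map_mx iota s = refl_mx.
Hypothesis gA : forall i, lat_maps iota f g (latA i) (latA i).

Lemma refl_xi_value t : free_at iota q J (idx t) -> type_I iota q J (idx t) ->
  xi_value iota q f g (idx t) (p \o psi) (w t)%:R.
Proof.
move=> fr tI; have [b [JE bfree _]] := jordan_basis JS (idx t).
have bA := jordan_quot_basis fr JE bfree.
have [T TP] := lat_maps_basis (@gA (idx t)) bA.
have cJ c : J (idx t) (map_mx iota (c *m b)) by rewrite JE; exists c.
have bJ j : J (idx t) (map_mx iota (row j b)) by rewrite rowE; apply: cJ.
pose l x := bil x (e t) / 2 ^+ idx t.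
have /choice[Q QE] : forall c, exists a,
    iota a = q_half iota q (idx t) l (map_mx iota (c *m b)).
  move=> c; have [a ->] := q_half_integral (jordan_latA (cJ c)).
  by exists a; rewrite mul1r.
have Qf : quadratic_form Q by apply: q_half_quadratic QE.
have [d eE] : exists d, e t = map_mx iota (d *m b) by have := eJ t; rewrite {1}JE.
have /choice[m mE] : forall j, exists a, l (map_mx iota (row j b)) = iota a.
  move=> j; have [a] : pA 0 (l (map_mx iota (row j b))).
    by apply/(pA_div0 _ two_neq0 (idx t)); apply: jordan_bilJ.
  by rewrite mul1r; exists a.
(* In the basis b, x -> 2^-i <x, e_t> e_t is the column of pairings times the row of coordinates of
   e_t; T0 is the reflection, or the identity if t is not selected. *)
pose N : 'M[A]_(rk (idx t)) := (\col_j m j) *m d.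
pose T0 : 'M[A]_(rk (idx t)) := 1%:M - ((w t)%:R * v t) *: N.
have T0E : b *m s = T0 *m b.
  apply: (map_iota_inj iota_inj); apply/row_matrixP => j.
  rewrite map_mxM sE row_mul -!map_row (refl_mx_J (bJ j)) row_mul.
  rewrite /T0 raddfB /= row1 mulmxBl -rowE map_mxB; congr (_ - _).
  rewrite linearZ /= row_mul -scalemxAl map_mxZ.
  have -> : row j (\col_j m j) = (m j)%:M by apply/rowP => h; rewrite !mxE ord1.
  rewrite mul_scalar_mx -scalemxAl map_mxZ -eE -mE scalerA /l /refl_coef.
  by congr (_ *: _); ring.
pose psiT := map_mx psi T.
have psifK m1 n1 (M : 'M[A]_(m1, n1)) : map_mx (psi \o f) M = M.
  by apply/matrixP => j h; rewrite mxE /= psif.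
(* T is only constrained modulo X_i, but a combination of the rows of b that lies in X_i has even
   coefficients, so its specialization agrees with T0 over k. *)
have TT0 : map_mx (p \o psi) T = map_mx p T0.
  apply/matrixP => j h; rewrite [LHS]mxE [RHS]mxE /=; apply/eqP.
  rewrite -subr_eq0 -rmorphB; apply/eqP/p_ker.
  have [_ _ /(_ (row j (psiT - T0))) bind] := bA.
  have [|c] := bind _ h; last by rewrite !mxE; exists c.
  have [m' [c [y [yX Ey]]]] := TP j.
  have -> : row j (psiT - T0) *m b = - (map_mx psi c *m y).
    have /(congr1 (map_mx psi)) := Ey.
    rewrite map_row map_mxB !map_mxM psig -!map_mx_comp.
    rewrite !psifK => E.
    by rewrite -E T0E -mulmxBl row_mul -[psiT - T0]opprB raddfN mulNmx.
  rewrite raddfN; apply: (submodN (latX_submod _)).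
  exact: (submod_mulmx (latX_submod _)).
have repr_p (y : 'rV[k]_(rk (idx t))) : exists c, map_mx p c = y.
  have /choice[c cP] : forall j, exists a, p a = y 0 j by move=> j; apply: p_surj.
  by exists (\row_j c j); apply/rowP => j; rewrite !mxE.
exists (e t), l, (rk (idx t)), b, Q, T; split=> //; first split=> //.
  split=> [x xA|a x y _ _|x _].
  - by apply/(pA_div0 _ two_neq0 (idx t)); apply: xA.2; apply: jordan_latL (eJ t).
  - by rewrite /l bilDl bilZl; ring.
  - by rewrite subrr; apply: pA0.
rewrite TT0; split.
  move=> y; have [c <-] := repr_p y.
  have pE : (p \o psi) \o f =1 p by move=> a /=; rewrite psif.
  have reg2 := integers_reg2 iota_inj two_neq0.
  rewrite -map_mxM !(eq_qf_base _ _ pE) !qf_base_map //; congr (p _).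
  apply: iota_inj; rewrite !QE -mulmxA -T0E mulmxA map_mxM sE.
  exact: refl_q_half.
rewrite /dickson; congr (_%:R).
have -> : map_mx p T0 - 1%:M = - p ((w t)%:R * v t) *: map_mx p N.
  by rewrite /T0 map_mxB map_mx1 map_mxZ addrAC subrr add0r scaleNr.
case: (w t) => /=; last by rewrite mul0r rmorph0 oppr0 scale0r mxrank0.
rewrite mxrank_scale_nz; last first.
  rewrite oppr_eq0 mul1r; apply/eqP => /p_ker ev.
  by apply: (even_unitF (b := u t)) ev; rewrite mulrC.
(* If either factor of N vanished modulo 2, all pairings with e_t on J_i would be even: directly for
   the column, and through e_t in 2J_i for the row. *)
rewrite map_mxM rank1_mod2 // => ev; apply: (bil_e_odd tI) => x.
  rewrite JE => -[c ->]; rewrite (mulmx_sum_row c b) raddf_sum /= bil_suml; apply: pA_sum => j _.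
  rewrite map_mxZ bilZl; apply: pA_scale; apply/(pA_div1 _ two_neq0 (idx t)).
  by rewrite -/(l _) mE; apply/(pA1P iota_inj); have := ev j; rewrite mxE.
move=> xJ; rewrite eE (mulmx_sum_row d b) raddf_sum /= bil_sumr; apply: pA_sum => j _.
have [c ->] := ev j; rewrite map_mxZ bilZr rmorphM rmorph_nat -mulrA.
by apply/(pA_2M iota two_neq0); apply: pA_scale; apply: jordan_bilJ.
Qed.

End XiValue.

End Reflections.

End Jordan.

End Lattices.

(** * Surjectivity on points over the residue field *)

Lemma flat_id (A : comNzRingType) : flat (idfun : {rmorphism A -> A}).
Proof.
move=> r a x; rewrite map_mx_id // => xa0; exists 1%N, x, 1%:M.
by rewrite map_mx_id // mul1mx.
Qed.

Lemma Z2_bool (a : 'Z_2) : a = (a != 0)%:R.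
Proof. by case: a => [[|[|//]] ltm]; apply: val_inj. Qed.

Theorem theorem4p6 (F : fieldExtType Q2) (n : nat)
    (q : 'rV[integers F]_n -> integers F)
    (J : nat -> set 'rV[F]_n) (rk : nat -> nat)
    (B : comNzRingType) (f : {rmorphism integers F -> B}) (g : 'M[B]_n)
    (alpha : nat) (idx : 'I_alpha -> nat) :
  unramified F ->
  quadratic_form q ->
  bil_integral (integers_in F) q ->
  bil_nondegenerate (integers_in F) q ->
  jordan_splitting (integers_in F) q J rk ->
  represents_G (integers_in F) q f g ->
  injective idx ->
  (forall i, free_type_Ie1 (integers_in F) q J rk i <-> exists t, idx t = i) ->
  forall eps : 'I_alpha -> 'Z_2,
  exists (k : fieldType) (phi : {rmorphism B -> k}),
    phi 2 = 0 /\
    forall t, xi_value (integers_in F) q f g (idx t) phi (eps t).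
Proof.
move=> unr qf _ _ JS [_ [[gM _] _] univ] idx_inj idxP eps.
have inj := @integers_in_inj F; have two := fieldext_two_neq0 F.
have loc := unramified_unit unr; have nunit := unr.1.
have idxI t : free_type_Ie1 (integers_in F) q J rk (idx t) by apply/idxP; exists t.
have /choice[E EP] : forall t, exists euv : 'rV[F]_n * integers F * integers F,
    [/\ J (idx t) euv.1.1, is_e (integers_in F) q (idx t) euv.1.1,
        euv.1.2 * euv.2 = 1 &
        qV (integers_in F) q euv.1.1 = 2 ^+ (idx t).+1 * integers_in F euv.1.2].
  move=> t; have [e [u [v euv]]] :=
    characteristic_vector inj two nunit loc (integers_perfect unr) JS (idxI t).
  by exists (e, u, v).
pose w t := eps t != 0.
have eJ t : J (idx t) (E t).1.1 by case: (EP t).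
have eP t : is_e (integers_in F) q (idx t) (E t).1.1 by case: (EP t).
have uv t : (E t).1.2 * (E t).2 = 1 by case: (EP t).
have qVe t : qV (integers_in F) q (E t).1.1 =
    2 ^+ (idx t).+1 * integers_in F (E t).1.2 by case: (EP t).
have [s sE] := refl_mx_integral two JS (fun t => (E t).2) w eJ.
have sG : in_G (integers_in F) q idfun s.
  by apply: (refl_in_G inj two qf nunit loc JS idx_inj eJ uv qVe sE).
(* The universal property for the flat algebra A itself turns s into psi : B -> A; reducing modulo 2
   gives the point of the special fibre. *)
have [[psi [psif psig]] _] := univ _ _ _ (@flat_id _) sG.
have [k [p [psurj pker]]] := residue_field_exists nunit unr.2.
exists k, (p \o psi); split.
  by rewrite rmorph_nat -(rmorph_nat p); apply/pker; exists 1; rewrite mulr1.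
move=> t; rewrite [eps t]Z2_bool.
have [fr tI _ _] := idxI t.
have gA i : lat_maps (integers_in F) f g (latA (integers_in F) q i)
    (latA (integers_in F) q i) by case: (gM i) => -[].
exact: (refl_xi_value inj two nunit loc JS idx_inj eJ eP uv qVe psurj pker psif psig sE gA fr tI).
Qed.
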